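(* Let $(M,T)$ be an ideal triangulated compact 3-manifold whose boundary consists of surfaces of negative Euler characteristic, and let $n$ be the number of edges of $T$. Under the combinatorial curvature flow $dx_i/dt=K_i$ ($i=1,\dots,n$) on $L(M,T)$, the PL curvature $K_i(t)$ evolves according to a combinatorial heat equation $$\frac{dK_i(t)}{dt}=\sum_{j=1}^n a_{ij}K_j(t),\qquad i=1,\dots,n,$$ where the matrix $[a_{ij}]_{n\times n}$ (depending on the metric $x(t)$) is symmetric and negative definite. In particular, the total curvature $\sum_{i=1}^n K_i^2(t)$ is strictly decreasing along the flow unless $K_i(t)=0$ for all $i$.
   Context: Hyperideal tetrahedra. $\mathbb{H}^3$ denotes hyperbolic 3-space. A hyperideal tetrahedron is a compact convex polyhedron in $\mathbb{H}^3$ which is diffeomorphic (via a diffeomorphism of open neighborhoods) to a truncated tetrahedron in Euclidean 3-space (four hexagonal faces and four triangular faces, one triangular face for each vertex of the original tetrahedron) and whose four hexagonal faces are right-angled hyperbolic hexagons. Its six edges are the intersections of pairs of its hexagonal faces, and its six dihedral angles are the interior dihedral angles at these edges. A hyperideal tetrahedron is determined up to isometry by its six edge lengths. Ideal triangulations. Let $M$ be a compact 3-manifold with boundary consisting of surfaces of negative Euler characteristic. An ideal triangulation $T$ of $M$ is given by a finite collection of 3-simplexes together with an identification of their faces in pairs by (affine) homeomorphisms, such that the quotient space with a small regular neighborhood of each vertex removed is homeomorphic to $M$. The images of the edges, triangles and tetrahedra of the simplexes (truncated at the vertices) are called the edges, triangles and tetrahedra of $T$. Let $E=\{e_1,\dots,e_n\}$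 be the set of edges of $T$. Cone metrics. A hyperbolic cone metric associated to $T$ is an assignment $x:E\to\mathbb{R}_{>0}$ such that for each tetrahedron $t$ of $T$, the six numbers that $x$ assigns to the six edges of $t$ are the corresponding edge lengths of a hyperideal tetrahedron in $\mathbb{H}^3$ (gluing these hyperideal tetrahedra isometrically along their hexagonal faces gives a hyperbolic cone metric on $M$). The set of all of these is denoted $L(M,T)$, and is regarded as an open subset of $\mathbb{R}^n=\mathbb{R}^E$ with coordinates $x_i=x(e_i)$. Curvature and flow. For $x\in L(M,T)$, the PL curvature $K_i=K_i(x)$ at the edge $e_i$ is $2\pi$ minus the sum of the dihedral angles at $e_i$ of all the hyperideal tetrahedra around $e_i$ (counted with multiplicity, when several edges of a tetrahedron are identified to $e_i$). The combinatorial curvature flow is the system of ordinary differential equations $dx_i/dt=K_i(x)$, $i=1,\dots,n$, on $L(M,T)$, and $K_i(t)$ denotes $K_i(x(t))$ along a solution $x(t)$. *)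

(* Defs.v *)
(* MathComp and MathComp-Analysis; the field of real numbers is an arbitrary
   [R : realType]. *)
From HB Require Import structures.
From Stdlib Require Import Relation_Operators.
From mathcomp Require Import all_boot all_order all_algebra all_fingroup.
From mathcomp Require Import all_classical all_reals all_analysis.

Set Implicit Arguments.
Unset Strict Implicit.
Unset Printing Implicit Defensive.

Import Order.TTheory GRing.Theory Num.Theory.
Import numFieldNormedType.Exports.

Local Open Scope classical_set_scope.
Local Open Scope ring_scope.

(** * Smooth maps and diffeomorphisms between open subsets of R^m *)

Section Smooth.
Context {R : realType}.

Fixpoint Ck (m k : nat) (U : set 'rV[R]_m.+1) (f : 'rV[R]_m.+1 -> R) : Prop :=
  (forall p, U p -> {for p, continuous f}) /\
  if k is k'.+1 then
    forall j : 'I_m.+1, (forall p, U p -> derivable f p (delta_mx 0 j)) /\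
                        Ck k' U (fun p => 'D_(delta_mx 0 j) f p)
  else True.

Definition smooth_on (m n : nat) (U : set 'rV[R]_m.+1)
    (f : 'rV[R]_m.+1 -> 'rV[R]_n) : Prop :=
  forall (j : 'I_n) (k : nat), Ck k U (fun p => f p 0 j).

Definition diffeomorphism (m : nat) (U V : set 'rV[R]_m.+1)
    (f g : 'rV[R]_m.+1 -> 'rV[R]_m.+1) : Prop :=
  [/\ open U, open V, f @` U = V,
      forall p, U p -> g (f p) = p &
      smooth_on U f /\ smooth_on V g].

End Smooth.

(** * The truncated Euclidean tetrahedron *)

Section TruncatedTetrahedron.
Context {R : realType}.

(* Barycentric coordinates of a point of R^3 with respect to the simplex with
   vertices 0 (number 0) and the three basis vectors (numbers 1, 2, 3). *)
Definition bary (y : 'rV[R]_3) (i : 'I_4) : R :=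
  if unlift ord0 i is Some j then y 0 j else 1 - \sum_(j < 3) y 0 j.

(* Vertex i is cut off along the plane where the i-th barycentric coordinate
   equals 2/3; the four cuts are disjoint since 2/3 > 1/2. *)
Definition trunc_tet : set 'rV[R]_3 :=
  [set y | forall i, 0 <= bary y i <= 2 / 3].

Definition trunc_hex (i : 'I_4) : set 'rV[R]_3 :=
  trunc_tet `&` [set y | bary y i = 0].

Definition trunc_tri (i : 'I_4) : set 'rV[R]_3 :=
  trunc_tet `&` [set y | bary y i = 2 / 3].

End TruncatedTetrahedron.

(** * Hyperbolic 3-space (hyperboloid model) *)

Section Hyperbolic.
Context {R : realType}.
Implicit Types x y v a b : 'rV[R]_4.

Definition mdot x y : R :=
  - (x 0 ord0 * y 0 ord0) + \sum_(j < 3) x 0 (lift ord0 j) * y 0 (lift ord0 j).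

Definition H3 : set 'rV[R]_4 := [set x | mdot x x = -1 /\ 0 < x 0 ord0].

(* cosh d(x, y) = - <x, y>, with arcosh c = ln (c + sqrt (c^2 - 1)). *)
Definition hdist x y : R :=
  let c := - mdot x y in ln (c + Num.sqrt (c ^+ 2 - 1)).

(* Tangent vector at v pointing along the geodesic from v to a. *)
Definition hdir v a : 'rV[R]_4 := a + mdot a v *: v.

Definition hangle v a b : R :=
  acos (mdot (hdir v a) (hdir v b) /
        (Num.sqrt (mdot (hdir v a) (hdir v a)) *
         Num.sqrt (mdot (hdir v b) (hdir v b)))).

(* Global smooth chart of H^3: the inverse of the vertical projection. *)
Definition hchart (y : 'rV[R]_3) : 'rV[R]_4 :=
  \row_(i < 4) if unlift ord0 i is Some j then y 0 j
               else Num.sqrt (1 + \sum_(j < 3) y 0 j ^+ 2).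

End Hyperbolic.

(** * Hyperideal tetrahedra *)

(* Outward normals of the faces of a polyhedron with eight labelled faces: the
   hexagon [hexN i] is to be opposite to the truncated vertex i, and the
   triangle [triN i] is to truncate the vertex i. *)
Record marked_polyhedron (R : realType) := MarkedPolyhedron {
  hexN : 'I_4 -> 'rV[R]_4;
  triN : 'I_4 -> 'rV[R]_4
}.

Section Hyperideal.
Context {R : realType}.
Implicit Types Q : marked_polyhedron R.

Definition body Q : set 'rV[R]_4 :=
  [set x | H3 x /\
     forall i, mdot x (hexN Q i) <= 0 /\ mdot x (triN Q i) <= 0].

Definition hexF Q (i : 'I_4) : set 'rV[R]_4 :=
  body Q `&` [set x | mdot x (hexN Q i) = 0].

Definition triF Q (i : 'I_4) : set 'rV[R]_4 :=
  body Q `&` [set x | mdot x (triN Q i) = 0].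

(* The edge joining the truncated vertices k and l is the intersection of the
   two hexagons opposite to the other two vertices. *)
Definition edgeF Q (k l : 'I_4) : set 'rV[R]_4 :=
  \bigcap_(m in [set m | m != k /\ m != l]) hexF Q m.

(* Endpoint near the truncated vertex k of the edge joining k and l. *)
Definition vtx Q (k l : 'I_4) : 'rV[R]_4 := get (triF Q k `&` edgeF Q k l).

Definition edge_length Q (k l : 'I_4) : R := hdist (vtx Q k l) (vtx Q l k).

(* Interior dihedral angle between the hexagons i and j: the normals are
   outward, so it is pi minus the angle between them. *)
Definition dihedral Q (i j : 'I_4) : R :=
  acos (- mdot (hexN Q i) (hexN Q j) /
        (Num.sqrt (mdot (hexN Q i) (hexN Q i)) *
         Num.sqrt (mdot (hexN Q j) (hexN Q j)))).

(* Diffeomorphic to the truncated tetrahedron via a diffeomorphism of open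
   neighbourhoods, matching the labels of the faces. *)
Definition truncated_tetrahedral Q : Prop :=
  exists (U V : set 'rV[R]_3) (f g : 'rV[R]_3 -> 'rV[R]_3),
    [/\ diffeomorphism U V f g,
        hchart @^-1` body Q `<=` U,
        f @` (hchart @^-1` body Q) = trunc_tet &
        forall i, f @` (hchart @^-1` hexF Q i) = trunc_hex i /\
                  f @` (hchart @^-1` triF Q i) = trunc_tri i].

(* In the hexagon opposite to the fourth vertex, the sides meeting at
   [vtx k l] end at [vtx l k] and at [vtx k j]. *)
Definition right_angled_hexagons Q : Prop :=
  forall j k l : 'I_4, uniq [:: j; k; l] ->
    hangle (vtx Q k l) (vtx Q l k) (vtx Q k j) = pi / 2.

Definition hyperideal Q : Prop :=
  [/\ forall i, 0 < mdot (hexN Q i) (hexN Q i) /\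
                0 < mdot (triN Q i) (triN Q i),
      compact (body Q),
      truncated_tetrahedral Q &
      right_angled_hexagons Q].

(* An edge of a tetrahedron is a two-element set of vertices. *)
Definition has_lengths Q (len : {set 'I_4} -> R) : Prop :=
  forall k l : 'I_4, k != l -> edge_length Q k l = len [set k; l]%SET.

(* Dihedral angle at the edge e of the hyperideal tetrahedra with edge lengths
   len (unique up to isometry); unspecified if there is none. The hexagons
   meeting along e are those opposite to the vertices outside e. *)
Definition angle_of_lengths (len : {set 'I_4} -> R) (e : {set 'I_4}) : R :=
  get [set th | exists Q i j, [/\ hyperideal Q, has_lengths Q len, i != j,
                                  e = (~: [set i; j])%SET &
                                  th = dihedral Q i j]].

End Hyperideal.

(** * Ideal triangulations *)

(* Face pairing of a finite family T of tetrahedra with vertices 'I_4. The face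
   of t opposite to i is glued affinely to a face of [nbr t i]; its vertices
   j != i are sent to [gperm t i j], and [gperm t i i] is the vertex opposite
   to the target face. *)
Record face_pairing (T : finType) := FacePairing {
  nbr : T -> 'I_4 -> T;
  gperm : T -> 'I_4 -> {perm 'I_4};
  nbrK : forall t i, nbr (nbr t i) (gperm t i i) = t;
  gpermK : forall t i, gperm (nbr t i) (gperm t i i) = (gperm t i)^-1%g;
  face_moved : forall t i, (nbr t i, gperm t i i) != (t, i)
}.

Section Triangulation.
Context {T : finType}.
Variable G : face_pairing T.

Definition edge_step : rel (T * {set 'I_4}) := fun u v =>
  [exists i : 'I_4, (i \notin u.2) &&
     (v == (nbr G u.1 i, (gperm G u.1 i @: u.2)%SET))].

(* [lab] presents the set of edges of the triangulation as e_1, ..., e_n: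
   [lab t e] is the index of the image of the edge e of t. *)
Definition edge_labelling (n : nat) (lab : T -> {set 'I_4} -> 'I_n) : Prop :=
  (forall (t t' : T) (e e' : {set 'I_4}), #|e| = 2%N -> #|e'| = 2%N ->
     (lab t e = lab t' e' <-> connect edge_step (t, e) (t', e'))) /\
  (forall i : 'I_n, exists (t : T) (e : {set 'I_4}), #|e| = 2%N /\ lab t e = i).

(* The boundary of the truncated quotient is triangulated by the truncation
   triangles (t, i). The triangle (t, i) has a side (t, i, j) in the face of t
   opposite to j, and a vertex (t, i, k) on the edge of t joining i and k,
   where j, k != i. *)
Definition corner_step : rel (T * 'I_4) := fun u v =>
  [exists j : 'I_4, (j != u.2) && (v == (nbr G u.1 j, gperm G u.1 j u.2))].

Definition bside_step : rel (T * 'I_4 * 'I_4) := fun u v =>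
  let: (t, i, j) := u in v == (nbr G t j, gperm G t j i, gperm G t j j).

Definition bvertex_step : rel (T * 'I_4 * 'I_4) := fun u v =>
  let: (t, i, k) := u in
  [exists j : 'I_4, [&& j != i, j != k &
     v == (nbr G t j, gperm G t j i, gperm G t j k)]].

(* Vertices minus sides plus triangles, for the component of c. *)
Definition boundary_euler (c : T * 'I_4) : int :=
  let flags := [pred u : T * 'I_4 * 'I_4 |
                  connect corner_step c u.1 && (u.1.2 != u.2)] in
  (n_comp bvertex_step flags)%:Z - (n_comp bside_step flags)%:Z
    + #|connect corner_step c|%:Z.

Definition negative_boundary_euler : Prop := forall c, boundary_euler c < 0.

Definition point_step (R : realType) (u v : T * 'rV[R]_3) : Prop :=
  exists i, [/\ bary u.2 i = 0, v.1 = nbr G u.1 i &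
                forall j, bary v.2 (gperm G u.1 i j) = bary u.2 j].

(* M is homeomorphic to the quotient of the disjoint union of the truncated
   tetrahedra by the gluing: F induces a continuous bijection from this compact
   quotient onto M, which is a homeomorphism when M is Hausdorff. *)
Definition truncated_quotient (R : realType) (M : topologicalType) : Prop :=
  exists F : T -> 'rV[R]_3 -> M,
    [/\ forall t, {within trunc_tet, continuous (F t)},
        forall z, exists t y, trunc_tet y /\ F t y = z &
        forall t t' y y', trunc_tet y -> trunc_tet y' ->
          (F t y = F t' y' <->
           clos_refl_sym_trans _ (@point_step R) (t, y) (t', y'))].

End Triangulation.

Definition half_space (R : realType) : set 'rV[R]_3 := [set y | 0 <= y 0 ord0].

Definition compact_3manifold_with_boundary (R : realType)
    (M : topologicalType) : Prop :=
  [/\ compact [set: M], hausdorff_space M &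
      forall z : M, exists (U : set M) (W : set 'rV[R]_3)
          (f : M -> 'rV[R]_3) (g : 'rV[R]_3 -> M),
        [/\ open U /\ U z, open W,
            f @` U = W `&` @half_space R,
            forall p, U p -> g (f p) = p &
            {within U, continuous f} /\
            {within W `&` @half_space R, continuous g}]].

Definition ideal_triangulation (R : realType) (M : topologicalType)
    (T : finType) (G : face_pairing T) : Prop :=
  [/\ compact_3manifold_with_boundary R M,
      truncated_quotient G R M & negative_boundary_euler G].

(** * Cone metrics, curvature and the flow *)

Section Flow.
Context {R : realType} {T : finType} {n : nat}.
Variable lab : T -> {set 'I_4} -> 'I_n.
Implicit Types x : 'rV[R]_n.

Definition tet_lengths x (t : T) (e : {set 'I_4}) : R := x 0 (lab t e).

Definition cone_metric x : Prop :=
  (forall i, 0 < x 0 i) /\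
  (forall t, exists Q, hyperideal Q /\ has_lengths Q (tet_lengths x t)).

Definition curvature x (i : 'I_n) : R :=
  2 * pi - \sum_(t : T) \sum_(e : {set 'I_4} | (#|e| == 2%N) && (lab t e == i))
             angle_of_lengths (tet_lengths x t) e.

Definition curvature_flow (J : set R) (x : R -> 'rV[R]_n) : Prop :=
  forall s, J s -> cone_metric (x s) /\
    forall i, is_derive s (1 : R) (fun r => x r 0 i) (curvature (x s) i).

Definition total_curvature x : R := \sum_(i < n) curvature x i ^+ 2.

Definition negative_definite (A : 'M[R]_n) : Prop :=
  forall v : 'rV[R]_n, v != 0 -> (v *m A *m v^T) 0 0 < 0.

End Flow.

(* Main.v *)
(** Let V_i be the unit normals of the truncating planes of a hyperideal
    tetrahedron and N_i those of its hexagons.  Right angles make the N_i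
    proportional to the dual basis of the V_i, whose Gram matrix is H, with
    diagonal 1 and entries - cosh l_ij off the diagonal.  So the dihedral
    angles are explicit functions of the cofactors of H, and their Jacobian is
      d theta_k / d l_m = (- det H)^(-1/2) s_k M_km s_m,   s_k > 0,
    where M is a symmetric 6x6 matrix depending only on the cosines of the
    dihedral angles: opposite edges have entry 1, adjacent edges rs and rp have
    entry - cos theta_ps.  The curvature matrix is minus the sum over the
    tetrahedra of these Jacobians, so it is enough that M is positive definite.

    Let G be the Gram matrix of the N_i.  A kernel vector y of M, seen as a
    symmetric matrix Y with zero diagonal, satisfies 2 G Y G = G Z + Z G with Z
    diagonal, i.e. 2 Y = Z G^-1 + G^-1 Z; comparing diagonals gives Z = 0 and
    y = 0.  So M is nondegenerate as soon as the links of the vertices are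
    hyperbolic triangles, a condition that persists when all the cosines c are
    moved to c + t (1 - c), 0 <= t < 1.  At t = 1 a rescaled M is diagonal and
    positive, hence M was positive definite at t = 0.

    Finally K' = A K with A negative definite makes sum K_i^2 decrease strictly
    wherever K <> 0, and by Gronwall's inequality K cannot vanish at one time
    without vanishing at all times. *)
Require Import Defs.
From mathcomp Require Import all_boot all_order all_algebra all_fingroup.
From mathcomp Require Import all_classical all_reals all_analysis.
From mathcomp Require Import ring lra.

Set Implicit Arguments.
Unset Strict Implicit.
Unset Printing Implicit Defensive.

Import Order.TTheory GRing.Theory Num.Theory.
Import numFieldNormedType.Exports.

Local Open Scope classical_set_scope.
Local Open Scope ring_scope.

(** * Gram matrices of four vectors *)

Section Cofactors.
Variable R : realFieldType.
Implicit Types a b c d e x : R.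

(* The cofactors and the determinant of a symmetric 4x4 matrix with unit diagonal
   and entries - e, - x, - a, - b, - c, - d at pq, rs, pr, ps, qr, qs: [cof_off] is
   the cofactor at pq, and that at ss is [cof_diag e a c]. *)
Definition cof_diag a b c : R :=
  1 - a ^+ 2 - b ^+ 2 - c ^+ 2 - 2 * a * b * c.

Definition cof_off e x a b c d : R :=
  e * (1 - x ^+ 2) + a * c + b * d + x * (a * d + b * c).

Definition det4 e x a b c d : R :=
  1 - (e ^+ 2 + x ^+ 2 + a ^+ 2 + b ^+ 2 + c ^+ 2 + d ^+ 2)
  - 2 * (e * a * c + e * b * d + x * a * b + x * c * d)
  + e ^+ 2 * x ^+ 2 + a ^+ 2 * d ^+ 2 + b ^+ 2 * c ^+ 2
  - 2 * (e * x * a * d + e * x * b * c + a * b * c * d).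

(** Jacobi's identity: a 2 by 2 minor of the adjugate is the determinant times the complementary
    minor of the matrix. *)
Lemma cof_diag_off e x a b c d :
  cof_diag c d x * cof_diag a b x - cof_off e x a b c d ^+ 2
  = det4 e x a b c d * (1 - x ^+ 2).
Proof. rewrite /cof_diag /cof_off /det4; ring. Qed.

(* a, b, c are the cosines of the angles of a hyperbolic triangle; for instance
   a + b c is the product of two sines and the cosh of the side opposite to a. *)
Definition hyp_triangle a b c : bool :=
  [&& -1 < a < 1, -1 < b < 1, -1 < c < 1,
      0 < a + b * c, 0 < b + a * c, 0 < c + a * b & cof_diag a b c < 0].

Lemma hyp_triangle_rot a b c : hyp_triangle a b c -> hyp_triangle b c a.
Proof.
rewrite /hyp_triangle => /and5P[-> -> -> h1 /and3P[h2 h3 h4]] /=.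
apply/and4P; split; first by rewrite [c * a]mulrC.
- by rewrite [b * a]mulrC.
- by [].
- suff -> : cof_diag b c a = cof_diag a b c by [].
  by rewrite /cof_diag; ring.
Qed.

(* Decreasing an angle preserves the condition that the sum is less than pi. *)
Lemma hyp_triangle_raise a a' b c : a <= a' -> a' < 1 ->
  hyp_triangle a b c -> hyp_triangle a' b c.
Proof.
rewrite /hyp_triangle => aa' a'1 /and5P[/andP[a0 a1] /andP[b0 b1] /andP[c0 c1] h1].
move=> /and3P[h2 h3 h4].
(* As [a' < 1], this bounds [b + a' * c] from below when [c] is negative, and [c + a' * b] when [b]
   is. *)
have bc : 0 < b + c.
  suff: 0 < (b + c) * (1 + a) by rewrite pmulr_lgt0 //; lra.
  by rewrite (_ : _ * _ = (b + a * c) + (c + a * b)); [lra | ring].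
rewrite b0 b1 c0 c1 a'1 (lt_le_trans a0 aa') /=.
apply/and4P; split.
- lra.
- have [c_ge0|c_lt0] := leP 0 c; first by nra.
  by nra.
- have [b_ge0|b_lt0] := leP 0 b; first by nra.
  by nra.
- suff: cof_diag a' b c <= cof_diag a b c by lra.
  rewrite -subr_ge0 (_ : _ - _ = (a' - a) * (2 * (a + b * c) + (a' - a))).
    by apply: mulr_ge0; lra.
  by rewrite /cof_diag; ring.
Qed.

Lemma hyp_triangle_raise3 a b c a' b' c' : a <= a' -> b <= b' -> c <= c' ->
  a' < 1 -> b' < 1 -> c' < 1 -> hyp_triangle a b c -> hyp_triangle a' b' c'.
Proof.
move=> aa' bb' cc' a'1 b'1 c'1 /(hyp_triangle_raise aa' a'1)/hyp_triangle_rot.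
move=> /(hyp_triangle_raise bb' b'1)/hyp_triangle_rot.
by move=> /(hyp_triangle_raise cc' c'1)/hyp_triangle_rot.
Qed.

(** By [cof_diag_off] and [1 - x ^+ 2 > 0], the sign is that of a 2 by 2 minor of the adjugate. In
    terms of [U], [U'] and [X] that minor is minus a sum of positive terms; [B * D < X ^+ 2]
    restates that the cofactor at rr is negative. *)
Lemma det4_lt0 e x a b c d :
  hyp_triangle e a c -> hyp_triangle e b d -> hyp_triangle a b x ->
  hyp_triangle c d x -> det4 e x a b c d < 0.
Proof.
rewrite /hyp_triangle => _ /and5P[_ /andP[b0 b1] /andP[d0 d1] h1 /and3P[_ _ h1']].
move=> /and5P[_ _ /andP[x0 x1] h2 _] /and5P[_ _ _ h3 _].
have k0 : 0 < 1 - x ^+ 2 by nra.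
have kb : 0 < 1 - b ^+ 2 by nra.
have kd : 0 < 1 - d ^+ 2 by nra.
rewrite -(pmulr_llt0 _ k0) -cof_diag_off.
set U := a + b * x in h2; set U' := c + d * x in h3.
set X := e + b * d in h1; set k := 1 - x ^+ 2 in k0 *.
have -> : cof_off e x a b c d = U * U' + k * X by rewrite /cof_off /U /U' /X /k; ring.
have -> : cof_diag c d x = k * (1 - d ^+ 2) - U' ^+ 2 by rewrite /cof_diag /U' /k; ring.
have -> : cof_diag a b x = k * (1 - b ^+ 2) - U ^+ 2 by rewrite /cof_diag /U /k; ring.
have hX : (1 - b ^+ 2) * (1 - d ^+ 2) < X ^+ 2.
  rewrite -subr_lt0 (_ : _ - _ = cof_diag e b d) //.
  by rewrite /cof_diag /X; ring.
move: kb kd hX; set B := 1 - b ^+ 2; set D := 1 - d ^+ 2 => kb kd hX.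
rewrite (_ : _ - _ = - (k * (D * U ^+ 2 + B * U' ^+ 2 + 2 * U * U' * X)
   + k ^+ 2 * (X ^+ 2 - B * D))); last by ring.
rewrite oppr_lt0; apply: addr_gt0.
  apply: mulr_gt0 => //.
  apply: addr_gt0; first by apply: addr_gt0; apply: mulr_gt0 => //; apply: exprn_gt0.
  by rewrite !mulr_gt0.
by apply: mulr_gt0; [exact: exprn_gt0 | lra].
Qed.

(** The conditions of [hyp_triangle] with denominators cleared. In the application each F is an edge
    cofactor and each squared f is minus a vertex cofactor. *)
Lemma hyp_triangle_normalized (fp fq fr Fpq Fpr Fqr : R) :
  0 < fp -> 0 < fq -> 0 < fr ->
  Fpq ^+ 2 < fp ^+ 2 * fq ^+ 2 -> Fpr ^+ 2 < fp ^+ 2 * fr ^+ 2 ->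
  Fqr ^+ 2 < fq ^+ 2 * fr ^+ 2 ->
  0 < Fpq * fr ^+ 2 + Fpr * Fqr -> 0 < Fpr * fq ^+ 2 + Fpq * Fqr ->
  0 < Fqr * fp ^+ 2 + Fpq * Fpr ->
  (fp ^+ 2 * fr ^+ 2 - Fpr ^+ 2) * (fq ^+ 2 * fr ^+ 2 - Fqr ^+ 2)
    < (Fpq * fr ^+ 2 + Fpr * Fqr) ^+ 2 ->
  hyp_triangle (Fpq / (fp * fq)) (Fpr / (fp * fr)) (Fqr / (fq * fr)).
Proof.
move=> p0 q0 r0 h1 h2 h3 s1 s2 s3 hd.
have lt1 (f g F : R) : 0 < f -> 0 < g -> F ^+ 2 < f ^+ 2 * g ^+ 2 ->
    -1 < F / (f * g) < 1.
  move=> f0 g0 h; rewrite -ltr_norml -(ltr_pXn2r (n := 2)) ?nnegrE //.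
  rewrite real_normK ?num_real // expr1n expr_div_n ltr_pdivrMr ?exprn_gt0 ?mulr_gt0 //.
  by rewrite mul1r exprMn.
have np : fp != 0 by lra.
have nq : fq != 0 by lra.
have nr : fr != 0 by lra.
rewrite /hyp_triangle !lt1 //=; apply/and4P; split.
- rewrite (_ : _ + _ = (Fpq * fr ^+ 2 + Fpr * Fqr) / (fp * fq * fr ^+ 2)).
    by rewrite divr_gt0 // !mulr_gt0.
  by field; rewrite np nq nr.
- rewrite (_ : _ + _ = (Fpr * fq ^+ 2 + Fpq * Fqr) / (fp * fr * fq ^+ 2)).
    by rewrite divr_gt0 // !mulr_gt0.
  by field; rewrite np nq nr.
- rewrite (_ : _ + _ = (Fqr * fp ^+ 2 + Fpq * Fpr) / (fq * fr * fp ^+ 2)).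
    by rewrite divr_gt0 // !mulr_gt0.
  by field; rewrite np nq nr.
- rewrite (_ : cof_diag _ _ _ = ((fp ^+ 2 * fr ^+ 2 - Fpr ^+ 2) *
     (fq ^+ 2 * fr ^+ 2 - Fqr ^+ 2) - (Fpq * fr ^+ 2 + Fpr * Fqr) ^+ 2)
     / (fp * fq * fr ^+ 2) ^+ 2).
    by rewrite pmulr_llt0 ?subr_lt0 // invr_gt0 exprn_gt0 // !mulr_gt0.
  by rewrite /cof_diag; field; rewrite np nq nr.
Qed.

(** The angles are those of the triangle truncating the vertex s. By Jacobi's identity every minor
    involved is the determinant times a minor of the Gram matrix, whose sign is visible because all
    the cosh values exceed 1. *)
Lemma hyp_triangle_cosines e x a b c d (fp fq fr : R) :
  1 < e -> 1 < x -> 1 < a -> 1 < b -> 1 < c -> 1 < d ->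
  det4 e x a b c d < 0 ->
  0 < fp -> 0 < fq -> 0 < fr ->
  fp ^+ 2 = - cof_diag c d x -> fq ^+ 2 = - cof_diag a b x -> fr ^+ 2 = - cof_diag e b d ->
  hyp_triangle (cof_off e x a b c d / (fp * fq)) (cof_off a d e b c x / (fp * fr))
      (cof_off c b e d a x / (fq * fr)).
Proof.
move=> e1 x1 a1 b1 c1 d1 D0 p0 q0 r0 hp hq hr.
have gt1 (y : R) : 1 < y -> 1 - y ^+ 2 < 0 by move=> ?; nra.
apply: hyp_triangle_normalized => //; rewrite ?hp ?hq ?hr.
- rewrite -subr_gt0 (_ : _ - _ = det4 e x a b c d * (1 - x ^+ 2)).
    by rewrite nmulr_lgt0 // gt1.
  by rewrite /cof_diag /cof_off /det4; ring.
- rewrite -subr_gt0 (_ : _ - _ = det4 e x a b c d * (1 - d ^+ 2)).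
    by rewrite nmulr_lgt0 // gt1.
  by rewrite /cof_diag /cof_off /det4; ring.
- rewrite -subr_gt0 (_ : _ - _ = det4 e x a b c d * (1 - b ^+ 2)).
    by rewrite nmulr_lgt0 // gt1.
  by rewrite /cof_diag /cof_off /det4; ring.
- rewrite (_ : _ + _ = - det4 e x a b c d * (e + b * d)).
    by rewrite mulr_gt0 ?oppr_gt0 //; nra.
  by rewrite /cof_diag /cof_off /det4; ring.
- rewrite (_ : _ + _ = - det4 e x a b c d * (a + b * x)).
    by rewrite mulr_gt0 ?oppr_gt0 //; nra.
  by rewrite /cof_diag /cof_off /det4; ring.
- rewrite (_ : _ + _ = - det4 e x a b c d * (c + d * x)).
    by rewrite mulr_gt0 ?oppr_gt0 //; nra.
  by rewrite /cof_diag /cof_off /det4; ring.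
- rewrite [X in X * _ < _](_ : _ = det4 e x a b c d * (1 - d ^+ 2)); last first.
    by rewrite /cof_diag /cof_off /det4; ring.
  rewrite [X in _ * X < _](_ : _ = det4 e x a b c d * (1 - b ^+ 2)); last first.
    by rewrite /cof_diag /cof_off /det4; ring.
  rewrite [X in _ < X ^+ 2](_ : _ = - det4 e x a b c d * (e + b * d)); last first.
    by rewrite /cof_diag /cof_off /det4; ring.
  rewrite -subr_gt0 (_ : _ - _ = det4 e x a b c d ^+ 2 * - cof_diag e b d).
    by apply: mulr_gt0; [rewrite exprn_even_gt0 //= lt_eqF | rewrite -hr exprn_gt0].
  by rewrite /cof_diag; ring.
Qed.

Lemma cof_diag_lt0 a b c : 1 < a -> 1 < b -> 1 < c -> cof_diag a b c < 0.
Proof.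
rewrite /cof_diag => a1 b1 c1.
have : 0 < a * b * c by rewrite !mulr_gt0 //; lra.
by nra.
Qed.

Definition e01 : 'I_6 := @Ordinal 6 0 isT.
Definition e02 : 'I_6 := @Ordinal 6 1 isT.
Definition e03 : 'I_6 := @Ordinal 6 2 isT.
Definition e12 : 'I_6 := @Ordinal 6 3 isT.
Definition e13 : 'I_6 := @Ordinal 6 4 isT.
Definition e23 : 'I_6 := @Ordinal 6 5 isT.

(** Lists make the entries compute at concrete indices, so that matrix identities reduce to
    polynomial ones entry by entry. *)
Definition sym4 (dg : nat -> R) (u : 'I_6 -> R) : 'M[R]_4 :=
  \matrix_(i, j) nth 0 (nth [::]
    [:: [:: dg 0; u e01; u e02; u e03];
        [:: u e01; dg 1; u e12; u e13];
        [:: u e02; u e12; dg 2; u e23];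
        [:: u e03; u e13; u e23; dg 3]]%N i) j.

Definition vcof (u : 'I_6 -> R) (i : nat) : R :=
  nth 0 [:: cof_diag (u e12) (u e13) (u e23);
            cof_diag (u e02) (u e03) (u e23);
            cof_diag (u e01) (u e03) (u e13);
            cof_diag (u e01) (u e02) (u e12)] i.

Definition ecof (u : 'I_6 -> R) (k : 'I_6) : R :=
  nth 0 [:: cof_off (u e01) (u e23) (u e02) (u e03) (u e12) (u e13);
            cof_off (u e02) (u e13) (u e01) (u e03) (u e12) (u e23);
            cof_off (u e03) (u e12) (u e01) (u e02) (u e13) (u e23);
            cof_off (u e12) (u e03) (u e01) (u e13) (u e02) (u e23);
            cof_off (u e13) (u e02) (u e01) (u e12) (u e03) (u e23);
            cof_off (u e23) (u e01) (u e02) (u e12) (u e03) (u e13)] k.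

Definition gram_det (u : 'I_6 -> R) : R :=
  det4 (u e01) (u e23) (u e02) (u e03) (u e12) (u e13).

Definition gram (u : 'I_6 -> R) := sym4 (fun=> 1) (fun k => - u k).
Definition gcof (u : 'I_6 -> R) := sym4 (vcof u) (ecof u).

Lemma mul_gram_gcof u : gram u *m gcof u = (gram_det u)%:M.
Proof.
apply/matrixP => i j; rewrite !mxE !big_ord_recl big_ord0 !mxE /=.
rewrite /vcof /ecof /gram_det /cof_diag /cof_off /det4.
case: i => [[|[|[|[|//]]]] ?]; case: j => [[|[|[|[|//]]]] ?] /=;
rewrite ?mulr1n ?mulr0n; ring.
Qed.

End Cofactors.

(** * Positive definiteness along a path *)

Section PositivePath.
Variable R : realType.

Lemma quadE n (A : 'M[R]_n) (u v : 'rV[R]_n) :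
  (u *m A *m v^T) 0 0 = \sum_j \sum_i u 0 i * A i j * v 0 j.
Proof.
by rewrite mxE; apply: eq_bigr => j _; rewrite !mxE mulr_suml.
Qed.

Lemma continuous_sum (U : topologicalType) n (F : 'I_n -> U -> R) :
  (forall i, continuous (F i)) -> continuous (fun x => \sum_i F i x).
Proof.
by move=> cF; apply: continuous_big => [|i _]; [exact: add_continuous|exact: cF].
Qed.

(** Moving from [v] by a small multiple of [- v *m A] changes the form, to first order, by a
    negative multiple of the squared length of [v *m A]; at an isotropic vector there is no room for
    that. *)
Lemma psd_isotropic n (A : 'M[R]_n) (v : 'rV[R]_n) : A^T = A ->
  (forall w : 'rV[R]_n, 0 <= (w *m A *m w^T) 0 0) ->
  (v *m A *m v^T) 0 0 <= 0 -> v *m A = 0.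
Proof.
move=> sA psd qv; set m := v *m A.
have q0 : (v *m A *m v^T) 0 0 = 0 by apply/eqP; rewrite eq_le qv psd.
have vm s : ((v - s *: m) *m A *m (v - s *: m)^T) 0 0 =
    - 2 * s * (m *m m^T) 0 0 + s ^+ 2 * (m *m A *m m^T) 0 0.
  have e1 : m *m A *m v^T = m *m m^T by rewrite /m trmx_mul sA mulmxA.
  rewrite [(v - s *: m)^T]linearB /= [(s *: m)^T]linearZ /=.
  rewrite !mulmxBl !mulmxBr -!scalemxAl -!scalemxAr -/m e1.
  rewrite -/m in q0; have mB (B C : 'M[R]_1) : (B - C) 0 0 = B 0 0 - C 0 0 by rewrite !mxE.
  have mZ a (B : 'M[R]_1) : (a *: B) 0 0 = a * B 0 0 by rewrite !mxE.
  by rewrite !(mB, mZ) q0; ring.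
have mm0 : 0 <= (m *m m^T) 0 0.
  by rewrite mxE sumr_ge0 // => i _; rewrite [X in _ * X]mxE -expr2 sqr_ge0.
have mm : (m *m m^T) 0 0 = 0.
  set N := (m *m m^T) 0 0 in mm0 vm *; set q := (m *m A *m m^T) 0 0 in vm.
  have q_ge0 : 0 <= q by exact: psd.
  (* This step length makes the value negative unless [N = 0]; the added 1 covers the case
     [q = 0]. *)
  have := psd (v - (N / (q + 1)) *: m); rewrite vm.
  have -> : - 2 * (N / (q + 1)) * N + (N / (q + 1)) ^+ 2 * q =
            - (N ^+ 2 * (q + 2) / (q + 1) ^+ 2).
    by field; rewrite gt_eqF // ltr_wpDl.
  rewrite oppr_ge0 pmulr_lle0 ?invr_gt0 ?exprn_gt0 ?ltr_wpDl //.
  rewrite pmulr_lle0 ?ltr_wpDl //.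
  by move=> h; apply/eqP; rewrite -sqrf_eq0 eq_le h sqr_ge0.
apply/rowP => i; rewrite [RHS]mxE; apply/eqP; rewrite -sqrf_eq0; apply/eqP.
move: mm; rewrite mxE => /eqP; rewrite psumr_eq0; last first.
  by move=> j _; rewrite [X in _ * X]mxE -expr2 sqr_ge0.
by move=> /allP /(_ i (mem_index_enum i)) /=; rewrite [X in _ * X]mxE -expr2 => /eqP.
Qed.

(* The last time at which the form takes a nonpositive value would be a time at
   which it is positive semidefinite and degenerate. *)
Lemma posdef_path n (M : R -> 'M[R]_n) :
  (forall i j, continuous (fun t => M t i j)) ->
  (forall t, 0 <= t <= 1 -> (M t)^T = M t) ->
  (forall t (v : 'rV[R]_n), 0 <= t < 1 -> v *m M t = 0 -> v = 0) ->
  (forall v : 'rV[R]_n, v != 0 -> 0 < (v *m M 1 *m v^T) 0 0) ->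
  forall v : 'rV[R]_n, v != 0 -> 0 < (v *m M 0 *m v^T) 0 0.
Proof.
move=> cM sM inj pd1 v0 v0n0; rewrite ltNge; apply/negP => q0.
pose q (p : R * 'rV[R]_n) := (p.2 *m M p.1 *m p.2^T) 0 0.
have cq : continuous q.
  have -> : q = fun p => \sum_j \sum_i p.2 0 i * M p.1 i j * p.2 0 j.
    by apply/funext => p; exact: quadE.
  apply: continuous_sum => j; apply: continuous_sum => i p.
  have cc k : (fun p : R * 'rV[R]_n => p.2 0 k) @ p --> p.2 0 k.
    apply: (@continuous_comp _ _ _ snd (fun v : 'rV[R]_n => v 0 k)).
      exact: cvg_snd.
    exact: coord_continuous.
  apply: cvgM; last exact: cc.
  apply: cvgM; first exact: cc.
  apply: (@continuous_comp _ _ _ fst (fun t => M t i j)); first exact: cvg_fst.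
  exact: cM.
have qZ t c v : q (t, c *: v) = c ^+ 2 * q (t, v).
  by rewrite /q /= linearZ /= -!scalemxAl -scalemxAr !mxE; ring.
(* By homogeneity unit vectors suffice, so the pairs with a nonpositive value form a compact set
   [K], on which the time attains its maximum. *)
pose S := [set p : R * 'rV[R]_n | 0 <= p.1 <= 1 /\ `|p.2| = 1].
pose K := S `&` [set p | q p <= 0].
have cS : compact S.
  have -> : S = `[0, 1]%classic `*` [set v : 'rV[R]_n | `|v| = 1].
    by apply/seteqP; split=> p /=; rewrite /S /= in_itv.
  apply: compact_setX; first exact: segment_compact.
  apply: bounded_closed_compact.
    by exists 1; split=> // r r1 v /= ->; exact: ltW.
  apply: (@closed_comp _ _ (fun v : 'rV[R]_n => `|v|) [set x | x = 1]).
    by move=> v _; exact: norm_continuous.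
  exact: closed_eq.
have cK : compact K.
  apply: compact_closedI => //.
  apply: (@closed_comp _ _ q [set x | x <= 0]); last exact: closed_le.
  by move=> p _; exact: cq.
have norm1 (v : 'rV[R]_n) : v != 0 -> `| `|v|^-1 *: v | = 1.
  by move=> vn0; rewrite normrZ normfV normr_id mulVf // normr_eq0.
have inK t v : 0 <= t <= 1 -> v != 0 -> q (t, v) <= 0 -> K (t, `|v|^-1 *: v).
  move=> t01 vn0 qv; split; first by split=> //; exact: norm1.
  by rewrite /= qZ mulr_ge0_le0 // sqr_ge0.
have K0 : K !=set0 by exists (0, `|v0|^-1 *: v0); apply: inK => //; rewrite lexx /=.
have cfst : {within K, continuous (fst : R * 'rV[R]_n -> R)}.
  by apply: continuous_subspaceT => p; exact: cvg_fst.
have [[t v] /set_mem [[/= t01 v1] qv] tmax] := compact_EVT_max K0 cK cfst.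
have vn0 : v != 0 by rewrite -normr_eq0 v1 oner_eq0.
have [t1|t1] := eqVneq t 1.
  by move: qv; rewrite /= /q /= t1 leNgt pd1.
have lt1 : t < 1 by rewrite lt_neqAle t1; case/andP: t01.
(* A direction with negative value at time [t] keeps a negative value slightly later, against the
   maximality of [t]. *)
have psd (w : 'rV[R]_n) : 0 <= (w *m M t *m w^T) 0 0.
  rewrite leNgt; apply/negP => qw.
  have wn0 : w != 0 by apply: contraTneq qw => ->; rewrite !mul0mx mxE ltxx.
  have cp : (s, w) @[s --> t] --> (t, w).
    exact: (cvg_pair cvg_id (cvg_cst w)).
  have cqw' : q (s, w) @[s --> t] --> q (t, w) := cvg_comp _ _ cp (cq _).
  have /nbhs_ballP[e /= e0 he] : \forall s \near t, q (s, w) < 0.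
    by apply: (cvgr_lt _ cqw').
  pose s : R := Order.min (t + e / 2) 1.
  have ts : t < s by rewrite lt_min lt1 andbT; lra.
  have s1 : s <= 1 by rewrite ge_min lexx orbT.
  have sb : s <= t + e / 2 by rewrite ge_min lexx.
  have qs : q (s, w) < 0.
    by apply: he; rewrite /ball /= distrC ger0_norm; lra.
  have := tmax (s, `|w|^-1 *: w); rewrite leNgt ts => /(_ _)/negP; apply => //.
  apply/mem_set/inK => //; last exact: ltW.
  by rewrite s1 andbT; lra.
have vM0 : v *m M t = 0 := psd_isotropic (sM t t01) psd qv.
move/eqP: vn0; apply; apply: (inj t) => //.
by rewrite lt1 andbT; case/andP: t01.
Qed.

End PositivePath.

Definition v0 : 'I_4 := @Ordinal 4 0 isT.
Definition v1 : 'I_4 := @Ordinal 4 1 isT.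
Definition v2 : 'I_4 := @Ordinal 4 2 isT.
Definition v3 : 'I_4 := @Ordinal 4 3 isT.

Lemma ord4P (P : 'I_4 -> Prop) :
  P v0 -> P v1 -> P v2 -> P v3 -> forall i, P i.
Proof.
move=> p0 p1 p2 p3 [[|[|[|[|//]]]] i]; rewrite (bool_irrelevance i isT) //.
Qed.

Lemma ord6P (P : 'I_6 -> Prop) :
  P e01 -> P e02 -> P e03 -> P e12 -> P e13 -> P e23 -> forall k, P k.
Proof.
by move=> p0 p1 p2 p3 p4 p5 [[|[|[|[|[|[|//]]]]]] k];
  rewrite (bool_irrelevance k isT).
Qed.

Lemma big4 (V : nmodType) (F : 'I_4 -> V) :
  \sum_i F i = F v0 + F v1
    + F v2 + F v3.
Proof.
rewrite !big_ord_recl big_ord0 addr0 !addrA.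
by congr (_ + _ + _ + _); congr (F _); apply: val_inj.
Qed.

Lemma big6 (V : nmodType) (F : 'I_6 -> V) :
  \sum_i F i = F e01 + F e02 + F e03 + F e12 + F e13 + F e23.
Proof.
rewrite !big_ord_recl big_ord0 addr0 !addrA.
by congr (_ + _ + _ + _ + _ + _); congr (F _); apply: val_inj.
Qed.

(** * The Hessian of the angles *)

Section HessianForm.
Variable R : realType.
Implicit Types g : 'I_6 -> R.

(** Here [a], [b] belong to the edges that meet the edge of [e] at one end and [c], [d] to those at
    the other end; [a], [c] lie in one face with [e], and [b], [d] in the other. *)
Definition wnum e a b c d : R := a * d + b * c + e * (a * c + b * d).

Definition ewnum g (k : 'I_6) : R :=
  nth 0 [:: wnum (g e01) (g e02) (g e03) (g e12) (g e13);
            wnum (g e02) (g e01) (g e03) (g e12) (g e23);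
            wnum (g e03) (g e01) (g e02) (g e13) (g e23);
            wnum (g e12) (g e01) (g e13) (g e02) (g e23);
            wnum (g e13) (g e01) (g e12) (g e03) (g e23);
            wnum (g e23) (g e02) (g e12) (g e03) (g e13)] k.

(** The diagonal is a separate argument, so that the off-diagonal pattern alone can be reused in the
    path of rescaled matrices, where the singular diagonal is treated apart. *)
Definition edge_mx (w g : 'I_6 -> R) : 'M[R]_6 :=
  \matrix_(i, j) nth 0 (nth [::]
    [:: [:: w e01; - g e12; - g e13; - g e02; - g e03; 1];
        [:: - g e12; w e02; - g e23; - g e01; 1; - g e03];
        [:: - g e13; - g e23; w e03; 1; - g e01; - g e02];
        [:: - g e02; - g e01; 1; w e12; - g e23; - g e13];
        [:: - g e03; 1; - g e01; - g e23; w e13; - g e12];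
        [:: 1; - g e03; - g e02; - g e13; - g e12; w e23]] i) j.

(* g k is the cosine of the dihedral angle at the edge k. *)
Definition hess g := edge_mx (fun k => ewnum g k / (1 - g k ^+ 2)) g.

(** The dihedral angles at the three edges from a vertex are the angles of its truncating
    triangle. *)
Definition hyp_links g : bool :=
  [&& hyp_triangle (g e01) (g e02) (g e03), hyp_triangle (g e01) (g e12) (g e13),
      hyp_triangle (g e02) (g e12) (g e23) & hyp_triangle (g e03) (g e13) (g e23)].

Lemma tr_edge_mx w g : (edge_mx w g)^T = edge_mx w g.
Proof. by apply/matrixP; do 2![apply: ord6P]; rewrite !mxE. Qed.

Lemma hyp_links_abs g k : hyp_links g -> -1 < g k < 1.
Proof.
move=> /and4P[/and5P[h0 h1 h2 _ _] /and5P[_ h3 h4 _ _] /and5P[_ _ h5 _ _] _].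
by move: k; apply: ord6P.
Qed.

Lemma hyp_links_sqr g k : hyp_links g -> 0 < 1 - g k ^+ 2.
Proof. by move=> /(hyp_links_abs k) /andP[? ?]; nra. Qed.

(* The two faces opposite to i and j meet along the edge opposite to ij. *)
Definition opp_edge g (k : 'I_6) : R :=
  nth 0 [:: g e23; g e13; g e12; g e03; g e02; g e01] k.

Lemma tr_sym4 (d : nat -> R) u : (sym4 d u)^T = sym4 d u.
Proof. by apply/matrixP; do 2![apply: ord4P]; rewrite !mxE. Qed.

Lemma gram_sym u p q : gram u p q = gram u q p :> R.
Proof. by move: p q; do 2![apply: ord4P]; rewrite !mxE. Qed.

(** For [p != q], the difference of the two sides is [1 - g k ^+ 2] times the k-th entry of
    [v *m hess g], where [k] is the edge along which the faces p and q meet. Thus a kernel vector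
    makes [Z] half the anticommutator of the Gram matrix with the diagonal of [Z]. *)
Lemma hess_gram g (v : 'rV[R]_6) : hyp_links g ->
  let Z := gram (opp_edge g) *m sym4 (fun=> 0) (v 0) *m gram (opp_edge g) in
  v *m hess g = 0 ->
  forall p q, Z p q = 2^-1 * gram (opp_edge g) p q * (Z p p + Z q q).
Proof.
move=> gg Z vM.
have nz k : 1 - g k ^+ 2 != 0 by rewrite gt_eqF // hyp_links_sqr.
have E k : (1 - g k ^+ 2) * \sum_i v 0 i * hess g i k = 0.
  by move/matrixP: vM => /(_ 0 k); rewrite !mxE => ->; rewrite mulr0.
have hE p q k : Z p q - 2^-1 * gram (opp_edge g) p q * (Z p p + Z q q)
    = (1 - g k ^+ 2) * \sum_i v 0 i * hess g i k ->
    Z p q = 2^-1 * gram (opp_edge g) p q * (Z p p + Z q q).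
  by rewrite E => /eqP; rewrite subr_eq0 => /eqP.
have symZ p q : Z p q = Z q p.
  have ZT : Z^T = Z by rewrite /Z !trmx_mul !tr_sym4 mulmxA.
  by rewrite -[in LHS]ZT mxE.
have symE p q : Z q p = 2^-1 * gram (opp_edge g) q p * (Z q q + Z p p) ->
    Z p q = 2^-1 * gram (opp_edge g) p q * (Z p p + Z q q).
  by rewrite gram_sym symZ [Z p p + _]addrC.
have diagE p : Z p p = 2^-1 * gram (opp_edge g) p p * (Z p p + Z p p).
  rewrite (_ : gram _ p p = 1); last by move: p; apply: ord4P; rewrite mxE.
  by field.
have offE : [/\ Z v0 v1 = 2^-1 * gram (opp_edge g) v0 v1 * (Z v0 v0 + Z v1 v1),
    Z v0 v2 = 2^-1 * gram (opp_edge g) v0 v2 * (Z v0 v0 + Z v2 v2),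
    Z v0 v3 = 2^-1 * gram (opp_edge g) v0 v3 * (Z v0 v0 + Z v3 v3),
    Z v1 v2 = 2^-1 * gram (opp_edge g) v1 v2 * (Z v1 v1 + Z v2 v2) &
    Z v1 v3 = 2^-1 * gram (opp_edge g) v1 v3 * (Z v1 v1 + Z v3 v3) /\
    Z v2 v3 = 2^-1 * gram (opp_edge g) v2 v3 * (Z v2 v2 + Z v3 v3)].
  by split; [apply: (hE _ _ e23)|apply: (hE _ _ e13)|apply: (hE _ _ e12)
    |apply: (hE _ _ e03)|split; [apply: (hE _ _ e02)|apply: (hE _ _ e01)]];
    rewrite /Z /hess !mxE !big4 !mxE !big4 !mxE !big6 !mxE /opp_edge /ewnum /= /wnum; field;
    exact: nz.
case: offE => h1 h2 h3 h4 [h5 h6].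
by do 2![apply: ord4P] => //; apply: symE.
Qed.

Lemma hess_inj g (v : 'rV[R]_6) : hyp_links g -> v *m hess g = 0 -> v = 0.
Proof.
move=> gg /(hess_gram gg); set G := gram (opp_edge g); set Y := sym4 _ _.
set Z := G *m Y *m G => EZ.
pose P := gcof (opp_edge g); pose D := gram_det (opp_edge g).
have D0 : D != 0.
  rewrite lt_eqF // (_ : D = det4 (g e01) (g e23) (g e02) (g e12) (g e03) (g e13)).
    by move: gg => /and4P[t0 t1 t2 t3]; exact: det4_lt0.
  by rewrite /D /gram_det /opp_edge /= /det4; ring.
have GP : G *m P = D%:M := mul_gram_gcof _.
have PG : P *m G = D%:M.
  by rewrite -[LHS]trmxK trmx_mul !tr_sym4 -/G -/P GP tr_scalar_mx.
(* The adjugate [P] replaces the inverse of [G], which avoids division. *)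
have PZP : P *m Z *m P = D ^+ 2 *: Y.
  rewrite /Z !mulmxA PG -!mulmxA GP mul_scalar_mx mul_mx_scalar scalerA.
  by rewrite expr2.
pose z := \row_p Z p p.
have ZE : Z = 2^-1 *: (diag_mx z *m G + G *m diag_mx z).
  apply/matrixP => p q; rewrite EZ mxE [in RHS]mxE mul_diag_mx mul_mx_diag.
  by rewrite !mxE -!/(Z _ _); ring.
have PZP' : P *m Z *m P = (2^-1 * D) *: (P *m diag_mx z + diag_mx z *m P).
  rewrite ZE -scalemxAr -scalemxAl mulmxDr mulmxDl !mulmxA PG.
  rewrite -(mulmxA (P *m diag_mx z) G P) GP mul_mx_scalar mul_scalar_mx.
  by rewrite -scalemxAl -scalerDr scalerA.
have P0 p : P p p != 0.
  rewrite lt_eqF //; move: gg => /and4P[/and5P[_ _ _ _ /and3P[_ _ t0]]].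
  move=> /and5P[_ _ _ _ /and3P[_ _ t1]] /and5P[_ _ _ _ /and3P[_ _ t2]].
  move=> /and5P[_ _ _ _ /and3P[_ _ t3]].
  rewrite /cof_diag in t0 t1 t2 t3.
  by move: p; apply: ord4P; rewrite mxE /= /vcof /= /cof_diag /opp_edge /=; lra.
have diagD (A : 'M[R]_4) (d : 'rV[R]_4) p :
    (A *m diag_mx d + diag_mx d *m A) p p = 2 * A p p * d 0 p.
  by rewrite mxE mul_diag_mx mul_mx_diag !mxE; ring.
(* [Y] has zero diagonal, while the other expression of [P *m Z *m P] has diagonal entries
   [D * P p p * Z p p], whose first two factors are nonzero. *)
have z0 p : Z p p = 0.
  have := congr1 (fun A : 'M[R]_4 => A p p) PZP'.
  rewrite PZP mxE [Y p p](_ : _ = 0); last by move: p; apply: ord4P; rewrite mxE.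
  rewrite mulr0 mxE diagD (_ : z 0 p = Z p p); last by rewrite mxE.
  rewrite (_ : _ * _ = D * P p p * Z p p); last by field.
  move=> /esym/eqP; rewrite !mulf_eq0 (negPf D0) (negPf (P0 p)) /=.
  by move/eqP.
have Y0 : Y = 0.
  have zz : z = 0 by apply/rowP => p; rewrite [RHS]mxE -(z0 p) [LHS]mxE.
  have : D ^+ 2 *: Y = 0.
    by rewrite -PZP PZP' zz linear0 mulmx0 mul0mx addr0 scaler0.
  by move=> /eqP; rewrite scaler_eq0 expf_eq0 (negPf D0) /= => /eqP.
have YE p q : Y p q = 0 by rewrite Y0 mxE.
apply/rowP; apply: ord6P; rewrite [RHS]mxE.
- by have := YE v0 v1; rewrite mxE.
- by have := YE v0 v2; rewrite mxE.
- by have := YE v0 v3; rewrite mxE.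
- by have := YE v1 v2; rewrite mxE.
- by have := YE v1 v3; rewrite mxE.
- by have := YE v2 v3; rewrite mxE.
Qed.

End HessianForm.

(** * Positive definiteness of the Hessian *)

Section HessianPositive.
Variable R : realType.
Implicit Types g : 'I_6 -> R.

Lemma cvg_edge_mx (T : Type) (F : set_system T) (FF : Filter F)
    (w g : T -> 'I_6 -> R) wl gl :
  (forall k, w t k @[t --> F] --> wl k) ->
  (forall k, g t k @[t --> F] --> gl k) ->
  forall i j, edge_mx (w t) (g t) i j @[t --> F] --> edge_mx wl gl i j.
Proof.
move=> cw cg; do 2![apply: ord6P]; rewrite mxE;
  under eq_fun do rewrite mxE /=;
  by [exact: cw | apply: cvgN; exact: cg | exact: cvg_cst].
Qed.

Lemma cvg_wnum (T : Type) (F : set_system T) (FF : Filter F)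
    (e a b c d : T -> R) el al bl cl dl :
  e t @[t --> F] --> el -> a t @[t --> F] --> al -> b t @[t --> F] --> bl ->
  c t @[t --> F] --> cl -> d t @[t --> F] --> dl ->
  wnum (e t) (a t) (b t) (c t) (d t) @[t --> F] --> wnum el al bl cl dl.
Proof.
move=> ce ca cb cc cd; apply: cvgD; first by apply: cvgD; apply: cvgM.
by apply: cvgM => //; apply: cvgD; apply: cvgM.
Qed.

Lemma cvg_ewnum (T : Type) (F : set_system T) (FF : Filter F)
    (g : T -> 'I_6 -> R) gl :
  (forall k, g t k @[t --> F] --> gl k) ->
  forall k, ewnum (g t) k @[t --> F] --> ewnum gl k.
Proof. by move=> cg; apply: ord6P; rewrite /ewnum /=; apply: cvg_wnum. Qed.

Let up g t k := g k + t * (1 - g k).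

Let up_hyp_links g t : hyp_links g -> 0 <= t < 1 -> hyp_links (up g t).
Proof.
move=> gg /andP[t0 t1].
have le_up k : g k <= up g t k.
  have /andP[_ ?] := hyp_links_abs k gg.
  by rewrite /up lerDl mulr_ge0 // subr_ge0 ltW.
have up_lt1 k : up g t k < 1 by have /andP[? ?] := hyp_links_abs k gg; rewrite /up; nra.
by move: gg => /and4P[h0 h1 h2 h3]; apply/and4P; split;
  [move: h0|move: h1|move: h2|move: h3]; apply: hyp_triangle_raise3.
Qed.

Lemma hess_posdef g (v : 'rV[R]_6) : hyp_links g -> v != 0 ->
  0 < (v *m hess g *m v^T) 0 0.
Proof.
move=> gg vn0.
(* M t is (1 - t)^-1 times hess (up g t) with row and column k scaled by
   1 - up g t k ^+ 2 = (1 - t) * h t k, which makes it polynomial in t. *)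
pose h t k := (1 - g k) * (1 + up g t k).
have h_gt0 t k : 0 <= t <= 1 -> 0 < h t k.
  move=> /andP[t0 t1]; have /andP[g0 g1] := hyp_links_abs k gg.
  by apply: mulr_gt0; rewrite /up; nra.
have up_sqr t k : 1 - up g t k ^+ 2 = (1 - t) * h t k by rewrite /h /up; ring.
pose M t : 'M[R]_6 := \matrix_(i, j)
  ((i == j)%:R * (ewnum (up g t) i * h t i)
   + (1 - t) * h t i * edge_mx (fun=> 0) (up g t) i j * h t j).
have ME t i j : t != 1 -> (forall k, h t k != 0) ->
    M t i j = (1 - t) * (h t i * hess (up g t) i j * h t j).
  move=> tn1 hn0; have tn0 : 1 - t != 0 by rewrite subr_eq0 eq_sym.
  have [->|/negPf nij] := eqVneq i j.
    rewrite mxE eqxx; move: j hn0; apply: ord6P => hn0;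
      rewrite !mxE /= up_sqr; field; by rewrite tn0 hn0.
  rewrite mxE nij mul0r add0r -!mulrA; congr (_ * (_ * (_ * _))).
  by move: i j nij; do 2![apply: ord6P] => // _; rewrite !mxE.
(* Away from [t = 1] the matrix [M t] is congruent, up to a positive factor, to [hess (up g t)];
   this carries over both injectivity and the value at [t = 0]. *)
have quadM t (u : 'rV[R]_6) : t != 1 -> (forall k, h t k != 0) ->
    u *m M t = (1 - t) *: ((\row_k (h t k * u 0 k)) *m hess (up g t)
                           *m diag_mx (\row_k h t k)).
  move=> tn1 hn0; apply/rowP => j.
  rewrite mxE [in RHS]mxE mul_mx_diag [X in _ = _ * X]mxE mxE mulr_suml mulr_sumr.
  by apply: eq_bigr => i _; rewrite ME // !mxE; ring.
pose w : 'rV[R]_6 := \row_k (v 0 k / h 0 k).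
have hn0 t : 0 <= t <= 1 -> forall k, h t k != 0.
  by move=> t01 k; rewrite gt_eqF // h_gt0.
have h0 : forall k, h 0 k != 0 by apply: hn0; rewrite lexx ler01.
have hw : \row_k (h 0 k * w 0 k) = v.
  by apply/rowP => k; rewrite !mxE mulrC divfK.
have up0 : up g 0 = g by apply/funext => k; rewrite /up mul0r addr0.
have -> : v *m hess g *m v^T = w *m M 0 *m w^T.
  rewrite quadM // ?[_ == 1]eq_sym ?oner_eq0 // subr0 scale1r hw up0 -!mulmxA.
  congr (_ *m (_ *m _)).
  apply/matrixP => k j; rewrite mul_diag_mx !mxE mulrC divfK //.
  by rewrite [j]ord1.
apply: (posdef_path (M := M)).
- move=> i j t.
  have cup k : (fun s => up g s k) @ t --> up g t k.
    by apply: cvgD; [exact: cvg_cst|apply: cvgM; [exact: cvg_id|exact: cvg_cst]].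
  have ch k : (fun s => h s k) @ t --> h t k.
    apply: cvgM; first exact: cvg_cst.
    by apply: cvgD; [exact: cvg_cst|exact: cup].
  have -> : (fun s => M s i j) = fun s => (i == j)%:R * (ewnum (up g s) i * h s i)
      + (1 - s) * h s i * edge_mx (fun=> 0) (up g s) i j * h s j.
    by apply/funext => s; rewrite mxE.
  apply: cvgD.
    apply: cvgM; first exact: cvg_cst.
    by apply: cvgM; [exact: cvg_ewnum|exact: ch].
  apply: cvgM; last exact: ch.
  apply: cvgM; last by apply: cvg_edge_mx => // k; exact: cvg_cst.
  apply: cvgM; last exact: ch.
  by apply: cvgB; [exact: cvg_cst|exact: cvg_id].
- move=> t _; apply/matrixP => i j.
  have sE : edge_mx (fun=> 0) (up g t) j i = edge_mx (fun=> 0) (up g t) i j.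
    by have /matrixP/(_ i j) := tr_edge_mx (fun=> 0) (up g t); rewrite [_^T _ _]mxE.
  rewrite [LHS]mxE [LHS]mxE [RHS]mxE eq_sym sE.
  have [->|_] := eqVneq i j; [by ring | by rewrite !mul0r !add0r; ring].
- move=> t u t01.
  have t1 : t != 1 by rewrite lt_eqF //; case/andP: t01.
  have t01' : 0 <= t <= 1 by case/andP: t01 => -> /ltW ->.
  rewrite quadM //; last exact: hn0.
  move/eqP; rewrite scaler_eq0 subr_eq0 [1 == _]eq_sym (negPf t1) /= => /eqP E.
  have {}E : (\row_k (h t k * u 0 k)) *m hess (up g t) = 0.
    move: E; move: (_ *m hess _) => A /rowP E; apply/rowP => k; move: (E k).
    rewrite mul_mx_diag !mxE => /eqP.
    by rewrite mulf_eq0 (negPf (hn0 _ t01' k)) orbF => /eqP.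
  have := hess_inj (up_hyp_links gg t01) E.
  move=> /rowP E'; apply/rowP => k; have := E' k; rewrite !mxE => /eqP.
  by rewrite mulf_eq0 (negPf (hn0 _ t01' k)) /= => /eqP.
- move=> u un0.
  have [k uk] : exists k, u 0 k != 0 by apply/rV0Pn.
  (* With all cosines equal to 1, each [ewnum] is 4 and [h 1 i = 2 * (1 - g i)]. *)
  have M1 i j : M 1 i j = (i == j)%:R * (8 * (1 - g i)).
    rewrite mxE subrr !mul0r addr0; congr (_ * _).
    have -> : up g 1 = fun=> 1 by apply/funext => l; rewrite /up; ring.
    rewrite /h /up; suff -> : ewnum (fun=> 1) i = 4 :> R by ring.
    by move: i; apply: ord6P; rewrite /ewnum /= /wnum; ring.
  have g1 i : 0 < 1 - g i by have /andP[_ ?] := hyp_links_abs i gg; rewrite subr_gt0.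
  rewrite quadE (bigD1 k) //=.
  have Ej j : \sum_i u 0 i * M 1 i j * u 0 j = 8 * (1 - g j) * u 0 j ^+ 2.
    rewrite (bigD1 j) //= big1; first by rewrite M1 eqxx mulr1n; ring.
    by move=> i /negPf nij; rewrite M1 nij mul0r mulr0 mul0r.
  rewrite Ej; under eq_bigr do rewrite Ej.
  apply: ltr_wpDr.
    apply: sumr_ge0 => i _; apply: mulr_ge0; last exact: sqr_ge0.
    by rewrite mulr_ge0 // ltW.
  apply: mulr_gt0; first by rewrite mulr_gt0.
  by rewrite exprn_even_gt0.
- apply: contra_neq vn0 => w0; rewrite -hw w0.
  by apply/rowP => k; rewrite !mxE mulr0.
Qed.

End HessianPositive.

(** * Dihedral angles as functions of the edge lengths *)

Section AngleDerivative.
Variable R : realType.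
Implicit Types (f g : R -> R) (s : R).

Lemma is_derive_addf f g s df dg : is_derive s 1 f df -> is_derive s 1 g dg ->
  is_derive s 1 (fun t => f t + g t) (df + dg).
Proof. by move=> hf hg; exact: is_deriveD. Qed.

Lemma is_derive_oppf f s df : is_derive s 1 f df -> is_derive s 1 (fun t => - f t) (- df).
Proof. by move=> hf; exact: is_deriveN. Qed.

Lemma is_derive_mulf f g s df dg : is_derive s 1 f df -> is_derive s 1 g dg ->
  is_derive s 1 (fun t => f t * g t) (df * g s + f s * dg).
Proof.
move=> hf hg; apply: (is_derive_eq (is_deriveM hf hg)).
by rewrite /GRing.scale /=; ring.
Qed.

Lemma is_derive_constf (c : R) s : is_derive s 1 (fun=> c) 0.
Proof. exact: is_derive_cst. Qed.

Lemma is_derive_sqrf f s df : is_derive s 1 f df ->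
  is_derive s 1 (fun t => f t ^+ 2) (2 * f s * df).
Proof.
move=> hf; apply: (is_derive_eq (is_derive_mulf hf hf)); ring.
Qed.

Lemma is_derive_invf f s df : is_derive s 1 f df -> f s != 0 ->
  is_derive s 1 (fun t => (f t)^-1) (- df / f s ^+ 2).
Proof.
move=> hf f0; apply: (is_derive_eq (is_deriveV f0 hf)).
by rewrite /GRing.scale /= mulNr mulNr mulrC.
Qed.

Lemma is_derive_sqrtf f s df : is_derive s 1 f df -> 0 < f s ->
  is_derive s 1 (fun t => Num.sqrt (f t)) (df / (2 * Num.sqrt (f s))).
Proof.
move=> hf f0; apply: (is_derive_eq (is_derive1_comp (is_derive1_sqrt f0) hf)).
exact: mulrC.
Qed.

Lemma is_derive_cof_off (e x a b c d : R -> R) (s de dx da db dc dd : R) :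
  is_derive s 1 e de -> is_derive s 1 x dx -> is_derive s 1 a da ->
  is_derive s 1 b db -> is_derive s 1 c dc -> is_derive s 1 d dd ->
  is_derive s 1 (fun t => cof_off (e t) (x t) (a t) (b t) (c t) (d t))
    (de * (1 - x s ^+ 2) + dx * (a s * d s + b s * c s - 2 * e s * x s)
     + da * (c s + x s * d s) + db * (d s + x s * c s)
     + dc * (a s + x s * b s) + dd * (b s + x s * a s)).
Proof.
move=> he hx ha hb hc hd.
have h1 := is_derive_addf (is_derive_constf 1 s) (is_derive_oppf (is_derive_sqrf hx)).
have h2 := is_derive_addf (is_derive_mulf ha hd) (is_derive_mulf hb hc).
have h3 := is_derive_addf (is_derive_mulf he h1) (is_derive_mulf ha hc).
apply: (is_derive_eq (is_derive_addf (is_derive_addf h3 (is_derive_mulf hb hd))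
  (is_derive_mulf hx h2))).
ring.
Qed.

Lemma is_derive_cof_diag (a b c : R -> R) (s da db dc : R) :
  is_derive s 1 a da -> is_derive s 1 b db -> is_derive s 1 c dc ->
  is_derive s 1 (fun t => cof_diag (a t) (b t) (c t))
    (- 2 * (da * (a s + b s * c s) + db * (b s + a s * c s)
            + dc * (c s + a s * b s))).
Proof.
move=> ha hb hc.
have h1 := is_derive_addf (is_derive_constf 1 s) (is_derive_oppf (is_derive_sqrf ha)).
have h2 := is_derive_addf h1 (is_derive_oppf (is_derive_sqrf hb)).
have h3 := is_derive_addf h2 (is_derive_oppf (is_derive_sqrf hc)).
have h4 := is_derive_mulf (is_derive_mulf (is_derive_constf 2 s) ha) hb.
apply: (is_derive_eq (is_derive_addf h3 (is_derive_oppf (is_derive_mulf h4 hc)))).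
ring.
Qed.

(** The normalized cofactor at pq in the labelling of [cof_off]: the cosine of the angle between the
    faces p and q, at the edge rs whose length has cosh [x]. *)
Definition cos_of e x a b c d : R :=
  cof_off e x a b c d / (Num.sqrt (- cof_diag c d x) * Num.sqrt (- cof_diag a b x)).

(* With F = cof_off, P = cof_diag c d x and Q = cof_diag a b x, the derivative of
   arccos (F / sqrt (P Q)) is (F (P' / P + Q' / Q) / 2 - F') / sqrt (P Q - F^2),
   and P Q - F^2 = (-det)(x^2 - 1). *)
Lemma is_derive_angle (e x a b c d : R -> R) (s de dx da db dc dd : R) :
  is_derive s 1 e de -> is_derive s 1 x dx -> is_derive s 1 a da ->
  is_derive s 1 b db -> is_derive s 1 c dc -> is_derive s 1 d dd ->
  let P := cof_diag (c s) (d s) (x s) in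
  let Q := cof_diag (a s) (b s) (x s) in
  let F := cof_off (e s) (x s) (a s) (b s) (c s) (d s) in
  let D := det4 (e s) (x s) (a s) (b s) (c s) (d s) in
  P < 0 -> Q < 0 -> D < 0 -> 1 < x s ->
  is_derive s 1 (fun t => acos (cos_of (e t) (x t) (a t) (b t) (c t) (d t)))
    ((Num.sqrt (- D))^-1 * Num.sqrt (x s ^+ 2 - 1) *
     (de
      + dx * (2 * e s * x s - a s * d s - b s * c s
              - F * ((x s + c s * d s) / P + (x s + a s * b s) / Q))
        / (x s ^+ 2 - 1)
      + da * cof_off (c s) (b s) (e s) (d s) (a s) (x s) / Q
      + db * cof_off (d s) (a s) (e s) (c s) (b s) (x s) / Q
      + dc * cof_off (a s) (d s) (e s) (b s) (c s) (x s) / P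
      + dd * cof_off (b s) (c s) (e s) (a s) (d s) (x s) / P)).
Proof.
move=> he hx ha hb hc hd P Q F D P0 Q0 D0 x1.
have x2 : 0 < x s ^+ 2 - 1 by nra.
have PQF : P * Q - F ^+ 2 = - D * (x s ^+ 2 - 1).
  by rewrite /P /Q /F cof_diag_off -/D; ring.
have p0 : 0 < - P by rewrite oppr_gt0.
have q0 : 0 < - Q by rewrite oppr_gt0.
have sp := is_derive_sqrtf (is_derive_oppf (is_derive_cof_diag hc hd hx)) p0.
have sq := is_derive_sqrtf (is_derive_oppf (is_derive_cof_diag ha hb hx)) q0.
have hF := is_derive_cof_off he hx ha hb hc hd.
rewrite -/P -/Q in sp sq.
set p := Num.sqrt (- P) in sp; set q := Num.sqrt (- Q) in sq.
have pp : 0 < p by rewrite sqrtr_gt0.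
have qq : 0 < q by rewrite sqrtr_gt0.
have pE : P = - p ^+ 2 by rewrite sqr_sqrtr ?opprK // ltW.
have qE : Q = - q ^+ 2 by rewrite sqr_sqrtr ?opprK // ltW.
have pq0 : p * q != 0 by rewrite mulf_neq0 // gt_eqF.
have hG := is_derive_mulf hF (is_derive_invf (is_derive_mulf sp sq) pq0).
have G2 : 1 - (F / (p * q)) ^+ 2 = - D * (x s ^+ 2 - 1) / (p * q) ^+ 2.
  by rewrite -PQF pE qE; field; rewrite !gt_eqF.
have sG : Num.sqrt (1 - (F / (p * q)) ^+ 2) =
    Num.sqrt (- D) * Num.sqrt (x s ^+ 2 - 1) / (p * q).
  rewrite G2 sqrtrM ?sqrtrM ?mulr_ge0 ?oppr_ge0 //; try exact: ltW.
  by rewrite sqrtrV ?exprn_ge0 ?mulr_ge0 ?ltW // sqrtr_sqr gtr0_norm ?mulr_gt0.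
have G1 : -1 < F / (p * q) < 1.
  rewrite -ltr_norml -(ltr_pXn2r (n := 2)) ?nnegrE //.
  rewrite real_normK ?num_real // expr1n -subr_gt0 G2.
  by rewrite divr_gt0 ?mulr_gt0 ?oppr_gt0 // exprn_gt0 // mulr_gt0.
have hA : is_derive (cos_of (e s) (x s) (a s) (b s) (c s) (d s)) 1 acos _ :=
  is_derive1_acos G1.
apply: (is_derive_eq (is_derive1_comp (g := fun t =>
  cos_of (e t) (x t) (a t) (b t) (c t) (d t)) hA hG)).
rewrite sG.
set rD := Num.sqrt (- D); set rx := Num.sqrt (x s ^+ 2 - 1).
have rx0 : 0 < rx by rewrite sqrtr_gt0.
have rD0 : 0 < rD by rewrite sqrtr_gt0 oppr_gt0.
have rxE : rx ^+ 2 = x s ^+ 2 - 1 by rewrite sqr_sqrtr // ltW.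
have x20 : x s ^+ 2 - 1 != 0 by rewrite gt_eqF.
(* These four identities turn the partial derivatives in [a], [b], [c], [d] into single cofactors,
   which is what exposes the symmetry of the Jacobian. *)
have Ea : cof_off (c s) (b s) (e s) (d s) (a s) (x s) =
    - ((c s + x s * d s) * Q + F * (a s + b s * x s)) / rx ^+ 2.
  by rewrite rxE /F /Q /cof_off /cof_diag; field.
have Eb : cof_off (d s) (a s) (e s) (c s) (b s) (x s) =
    - ((d s + x s * c s) * Q + F * (b s + a s * x s)) / rx ^+ 2.
  by rewrite rxE /F /Q /cof_off /cof_diag; field.
have Ec : cof_off (a s) (d s) (e s) (b s) (c s) (x s) =
    - ((a s + x s * b s) * P + F * (c s + d s * x s)) / rx ^+ 2.
  by rewrite rxE /F /P /cof_off /cof_diag; field.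
have Ed : cof_off (b s) (c s) (e s) (a s) (d s) (x s) =
    - ((b s + x s * a s) * P + F * (d s + c s * x s)) / rx ^+ 2.
  by rewrite rxE /F /P /cof_off /cof_diag; field.
rewrite Ea Eb Ec Ed (_ : 1 - x s ^+ 2 = - rx ^+ 2); last by rewrite rxE; ring.
rewrite -rxE -/F pE qE -/p -/q.
by field; rewrite !gt_eqF.
Qed.

End AngleDerivative.

(** * The rescaled Hessian in terms of cofactors *)

Section AngleMatrix.
Variable R : realType.
Implicit Types u : 'I_6 -> R.

(** The coefficient of [dx] in [is_derive_angle], that is, the dependence of a dihedral angle on its
    own edge. *)
Definition hess_diag (e x a b c d : R) : R :=
  (2 * e * x - a * d - b * c - cof_off e x a b c d *
     ((x + c * d) / cof_diag c d x + (x + a * b) / cof_diag a b x)) / (x ^+ 2 - 1).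

(** [I1], [I2] and [I3] are Jacobi's identity for further minors of the adjugate; they eliminate the
    products of cofactors, and the remaining cofactor at rs cancels. *)
Lemma hess_diagE (e x a b c d ap aq ar as_ gpq gpr gqr gps gqs : R) :
  0 < ap -> 0 < aq -> 0 < ar -> 0 < as_ ->
  cof_diag c d x = - ap ^+ 4 -> cof_diag a b x = - aq ^+ 4 ->
  det4 e x a b c d != 0 -> x ^+ 2 - 1 != 0 ->
  gpq = cof_off e x a b c d / (ap ^+ 2 * aq ^+ 2) ->
  gpr = cof_off a d e b c x / (ap ^+ 2 * ar ^+ 2) ->
  gqr = cof_off c b e d a x / (aq ^+ 2 * ar ^+ 2) ->
  gps = cof_off b c e a d x / (ap ^+ 2 * as_ ^+ 2) ->
  gqs = cof_off d a e c b x / (aq ^+ 2 * as_ ^+ 2) ->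
  ar * as_ / (ap * aq) * (wnum gpq gqs gps gqr gpr / (1 - gpq ^+ 2))
    * (ar * as_ / (ap * aq)) = hess_diag e x a b c d.
Proof.
move=> p0 q0 r0 s0 hP hQ D0 x0 gpqE -> -> -> ->.
have ap0 := lt0r_neq0 p0; have aq0 := lt0r_neq0 q0.
have ar0 := lt0r_neq0 r0; have as0 := lt0r_neq0 s0.
have I1 : cof_off a d e b c x * cof_off b c e a d x =
    cof_diag c d x * cof_off x e a c b d - det4 e x a b c d * (x + c * d).
  by rewrite /cof_off /cof_diag /det4; ring.
have I2 : cof_off c b e d a x * cof_off d a e c b x =
    cof_diag a b x * cof_off x e a c b d - det4 e x a b c d * (x + a * b).
  by rewrite /cof_off /cof_diag /det4; ring.
have I3 : cof_off a d e b c x * cof_off d a e c b x + cof_off b c e a d x * cof_off c b e d a x =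
    2 * cof_off e x a b c d * cof_off x e a c b d
    - det4 e x a b c d * (2 * e * x - a * d - b * c).
  by rewrite /cof_off /det4; ring.
have G2 : 1 - gpq ^+ 2 = det4 e x a b c d * (1 - x ^+ 2) / (ap ^+ 4 * aq ^+ 4).
  rewrite -cof_diag_off hP hQ gpqE; field; by rewrite ap0 aq0.
have x0' : 1 - x ^+ 2 != 0 by rewrite -opprB oppr_eq0.
rewrite G2 gpqE /wnum /hess_diag hP hQ.
move: I1 I2 I3 D0; rewrite hP hQ.
move: (cof_off e x a b c d) (cof_off a d e b c x) (cof_off c b e d a x) (cof_off b c e a d x)
  (cof_off d a e c b x) (cof_off x e a c b d) (det4 e x a b c d) => F Fpr Fqr Fps Fqs Frs D.
move=> I1 I2 I3 D0.
transitivity ((Fpr * Fqs + Fps * Fqr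
   + F * (Fpr * Fps / ap ^+ 4 + Fqr * Fqs / aq ^+ 4)) / (D * (1 - x ^+ 2))).
  by field; rewrite D0 x0' ap0 aq0 ar0 as0.
rewrite I1 I2 I3; field; by rewrite D0 x0 x0' ap0 aq0.
Qed.

(* For u = cosh of the edge lengths, the cosine of the dihedral angle at k. *)
Definition fcos u (k : 'I_6) : R :=
  nth 0 [:: cos_of (u e23) (u e01) (u e02) (u e12) (u e03) (u e13);
            cos_of (u e13) (u e02) (u e01) (u e12) (u e03) (u e23);
            cos_of (u e12) (u e03) (u e01) (u e13) (u e02) (u e23);
            cos_of (u e03) (u e12) (u e01) (u e02) (u e13) (u e23);
            cos_of (u e02) (u e13) (u e01) (u e03) (u e12) (u e23);
            cos_of (u e01) (u e23) (u e02) (u e03) (u e12) (u e13)] k.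

(** Fourth roots, because [escale] acts from both sides and the cosines already contain square roots
    of the cofactors. *)
Definition vroot u i : R := Num.sqrt (Num.sqrt (- vcof u i)).

Definition escale u (k : 'I_6) : R :=
  nth 0 [:: vroot u 0%N * vroot u 1%N / (vroot u 2%N * vroot u 3%N);
            vroot u 0%N * vroot u 2%N / (vroot u 1%N * vroot u 3%N);
            vroot u 0%N * vroot u 3%N / (vroot u 1%N * vroot u 2%N);
            vroot u 1%N * vroot u 2%N / (vroot u 0%N * vroot u 3%N);
            vroot u 1%N * vroot u 3%N / (vroot u 0%N * vroot u 2%N);
            vroot u 2%N * vroot u 3%N / (vroot u 0%N * vroot u 1%N)] k.

(* The matrix [hess (fcos u)] rescaled by [escale u], in terms of cofactors. *)
Definition cof_hess u : 'M[R]_6 :=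
  let r (k : 'I_6) i := ecof u k / vcof u i in
  \matrix_(i, j) nth 0 (nth [::]
    [:: [:: hess_diag (u e23) (u e01) (u e02) (u e12) (u e03) (u e13);
            r e03 3%N; r e02 2%N; r e13 3%N; r e12 2%N; 1];
        [:: r e03 3%N; hess_diag (u e13) (u e02) (u e01) (u e12) (u e03) (u e23);
            r e01 1%N; r e23 3%N; 1; r e12 1%N];
        [:: r e02 2%N; r e01 1%N;
            hess_diag (u e12) (u e03) (u e01) (u e13) (u e02) (u e23);
            1; r e23 2%N; r e13 1%N];
        [:: r e13 3%N; r e23 3%N; 1;
            hess_diag (u e03) (u e12) (u e01) (u e02) (u e13) (u e23);
            r e01 0%N; r e02 0%N];
        [:: r e12 2%N; 1; r e23 2%N; r e01 0%N;
            hess_diag (u e02) (u e13) (u e01) (u e03) (u e12) (u e23); r e03 0%N];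
        [:: 1; r e12 1%N; r e13 1%N; r e02 0%N; r e03 0%N;
            hess_diag (u e01) (u e23) (u e02) (u e03) (u e12) (u e13)]] i) j.

Variable u : 'I_6 -> R.
Hypothesis u1 : forall k, 1 < u k.
Hypothesis D0 : gram_det u < 0.

Lemma vcof_lt0 i : (i < 4)%N -> vcof u i < 0.
Proof.
by case: i => [|[|[|[|//]]]] _; rewrite /vcof /=; apply: cof_diag_lt0.
Qed.

Lemma vroot_gt0 i : (i < 4)%N -> 0 < vroot u i.
Proof. by move=> i4; rewrite !sqrtr_gt0 oppr_gt0 vcof_lt0. Qed.

Lemma vroot2 i : vroot u i ^+ 2 = Num.sqrt (- vcof u i).
Proof. by rewrite sqr_sqrtr // sqrtr_ge0. Qed.

Lemma vroot4 i : (i < 4)%N -> vcof u i = - vroot u i ^+ 4.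
Proof.
move=> i4; rewrite (exprM _ 2 2) vroot2 sqr_sqrtr ?opprK //.
by rewrite oppr_ge0 ltW // vcof_lt0.
Qed.

Lemma fcosE k : fcos u k = nth 0
  [:: ecof u e23 / (vroot u 2%N ^+ 2 * vroot u 3%N ^+ 2);
      ecof u e13 / (vroot u 1%N ^+ 2 * vroot u 3%N ^+ 2);
      ecof u e12 / (vroot u 1%N ^+ 2 * vroot u 2%N ^+ 2);
      ecof u e03 / (vroot u 0%N ^+ 2 * vroot u 3%N ^+ 2);
      ecof u e02 / (vroot u 0%N ^+ 2 * vroot u 2%N ^+ 2);
      ecof u e01 / (vroot u 0%N ^+ 2 * vroot u 1%N ^+ 2)] k.
Proof.
by move: k; apply: ord6P; rewrite !vroot2 /fcos /ecof /vcof /cos_of /=;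
  congr (_ / (Num.sqrt (- _) * Num.sqrt (- _))); rewrite /cof_diag /cof_off; ring.
Qed.

Lemma escale_gt0 k : 0 < escale u k.
Proof.
by move: k; apply: ord6P; rewrite /escale /= divr_gt0 // mulr_gt0 // vroot_gt0.
Qed.

Lemma hyp_triangle_swap (a b c : R) : hyp_triangle a b c -> hyp_triangle c b a.
Proof.
rewrite /hyp_triangle => /and5P[-> -> -> h1 /and3P[h2 h3 h4]] /=.
apply/and4P; split.
- by rewrite [b * a]mulrC.
- by rewrite [c * a]mulrC.
- by rewrite [c * b]mulrC.
- suff -> : cof_diag c b a = cof_diag a b c by [].
  by rewrite /cof_diag; ring.
Qed.

Lemma hyp_triangle_vertex (e x a b c d : R) (p q r : nat) Fqr Fpr Fpq :
  (p < 4)%N -> (q < 4)%N -> (r < 4)%N ->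
  1 < e -> 1 < x -> 1 < a -> 1 < b -> 1 < c -> 1 < d ->
  det4 e x a b c d = gram_det u ->
  vcof u p = cof_diag c d x -> vcof u q = cof_diag a b x -> vcof u r = cof_diag e b d ->
  Fpq = cof_off e x a b c d -> Fpr = cof_off a d e b c x -> Fqr = cof_off c b e d a x ->
  hyp_triangle (Fqr / (vroot u q ^+ 2 * vroot u r ^+ 2))
    (Fpr / (vroot u p ^+ 2 * vroot u r ^+ 2))
    (Fpq / (vroot u p ^+ 2 * vroot u q ^+ 2)).
Proof.
move=> p4 q4 r4 e1 x1 a1 b1 c1 d1 D vp vq vr -> -> ->; apply: hyp_triangle_swap.
by apply: hyp_triangle_cosines => //; rewrite ?D // ?exprn_gt0 ?vroot_gt0 // -exprM
  -?vp -?vq -?vr vroot4 ?opprK.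
Qed.

Lemma hyp_links_fcos : hyp_links (fcos u).
Proof.
rewrite /hyp_links !fcosE /=; apply/and4P; split.
- apply: (@hyp_triangle_vertex (u e12) (u e03) (u e13) (u e01) (u e23) (u e02)) => //;
  rewrite /gram_det /det4 /vcof /ecof /cof_off /cof_diag /=; ring.
- apply: (@hyp_triangle_vertex (u e02) (u e13) (u e03) (u e01) (u e23) (u e12)) => //;
  rewrite /gram_det /det4 /vcof /ecof /cof_off /cof_diag /=; ring.
- apply: (@hyp_triangle_vertex (u e01) (u e23) (u e03) (u e02) (u e13) (u e12)) => //;
  rewrite /gram_det /det4 /vcof /ecof /cof_off /cof_diag /=; ring.
- apply: (@hyp_triangle_vertex (u e01) (u e23) (u e02) (u e03) (u e12) (u e13)) => //;
  rewrite /gram_det /det4 /vcof /ecof /cof_off /cof_diag /=; ring.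
Qed.

(** Off the diagonal the roots cancel or combine to fourth powers, leaving a quotient of cofactors;
    the diagonal is [hess_diagE]. *)
Lemma cof_hessE k m : escale u k * hess (fcos u) k m * escale u m = cof_hess u k m.
Proof.
have v i i4 : vroot u i != 0 := lt0r_neq0 (@vroot_gt0 i i4).
have vc i (i4 : (i < 4)%N) : vcof u i != 0 by rewrite lt_eqF // vcof_lt0.
have u2 l : u l ^+ 2 - 1 != 0.
  by have := u1 l => ul; rewrite gt_eqF //; nra.
have D e x a b c d : det4 e x a b c d = gram_det u -> det4 e x a b c d != 0.
  by move=> ->; rewrite lt_eqF.
have diag e x a b c d p q r s gpq gpr gqr gps gqs := @hess_diagE e x a b c d
  (vroot u p) (vroot u q) (vroot u r) (vroot u s) gpq gpr gqr gps gqs.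
have [->|km] := eqVneq k m.
  move: m; apply: ord6P; rewrite !mxE /= /escale /ewnum /= !fcosE /=;
    apply: diag; rewrite ?vroot_gt0 // -?vroot4 //;
    try (apply: D; rewrite /gram_det /det4; ring);
    try (congr (_ / _); rewrite ?/ecof ?/cof_off /=; ring);
    rewrite /vcof /cof_diag /=; ring.
move: k m km; do 2![apply: ord6P] => //= _;
  rewrite !mxE /= /escale ?fcosE /= ?vroot4 //; field; rewrite ?v //.
Qed.

End AngleMatrix.

(** * Variation of the angles with the edge lengths *)

Section AngleVariation.
Variable R : realType.

Definition cosh (x : R) : R := (expR x + expR (- x)) / 2.
Definition sinh (x : R) : R := (expR x - expR (- x)) / 2.

Lemma expR_mulN (x : R) : expR x * expR (- x) = 1.
Proof. by rewrite -expRD subrr expR0. Qed.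

Lemma cosh2 x : cosh x ^+ 2 - 1 = sinh x ^+ 2.
Proof.
rewrite /cosh /sinh; have := expR_mulN x.
by move: (expR x) (expR _) => a b ab; field: ab.
Qed.

Lemma sinh_gt0 x : 0 < x -> 0 < sinh x.
Proof.
by move=> x0; rewrite divr_gt0 // subr_gt0 ltr_expR; lra.
Qed.

Lemma cosh_gt1 x : 0 < x -> 1 < cosh x.
Proof.
move=> x0; have := sinh_gt0 x0; have := cosh2 x.
have : 0 < cosh x by rewrite divr_gt0 // addr_gt0 // expR_gt0.
by move=> c0 cs s0; nra.
Qed.

Lemma is_derive_cosh (f : R -> R) (s df : R) : is_derive s 1 f df ->
  is_derive s 1 (fun t => cosh (f t)) (sinh (f s) * df).
Proof.
move=> hf.
have h1 := is_derive1_comp (is_derive_expR (f s)) hf.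
have h2 := is_derive1_comp (g := fun t => - f t) (is_derive_expR (- f s)) (is_derive_oppf hf).
apply: (is_derive_eq (is_derive_mulf (is_derive_addf h1 h2)
  (is_derive_constf 2^-1 s))).
by rewrite /sinh /=; field.
Qed.

(** The Jacobian of the angles, with scale factors [sinh (l k) * escale u k]. *)
Definition angle_mx (l : 'I_6 -> R) : 'M[R]_6 :=
  let u k := cosh (l k) in
  \matrix_(k, m) ((Num.sqrt (- gram_det u))^-1 *
    (sinh (l k) * (escale u k * hess (fcos u) k m * escale u m) * sinh (l m))).

Lemma is_derive_fcos (l : R -> 'I_6 -> R) (dl : 'I_6 -> R) (s : R) :
  (forall k, is_derive s 1 (fun t => l t k) (dl k)) ->
  (forall k, 0 < l s k) -> gram_det (fun k => cosh (l s k)) < 0 ->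
  forall k, is_derive s 1 (fun t => acos (fcos (fun k => cosh (l t k)) k))
    (\sum_m angle_mx (l s) k m * dl m).
Proof.
move=> hl l0 D0 k.
pose u t k := cosh (l t k).
have du i : is_derive s 1 (fun t => u t i) (sinh (l s i) * dl i).
  exact: is_derive_cosh.
have u1 i : 1 < u s i by exact: cosh_gt1.
have sE i : Num.sqrt (u s i ^+ 2 - 1) = sinh (l s i).
  by rewrite cosh2 sqrtr_sqr gtr0_norm // sinh_gt0.
have mE m : angle_mx (l s) k m * dl m = (Num.sqrt (- gram_det (u s)))^-1 *
    (sinh (l s k) * cof_hess (u s) k m * (sinh (l s m) * dl m)).
  by rewrite mxE cof_hessE //; ring.
under eq_bigr do rewrite mE.
have H e x a b c d (h1 : cof_diag (u s c) (u s d) (u s x) < 0)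
    (h2 : cof_diag (u s a) (u s b) (u s x) < 0) h3 :=
  is_derive_angle (du e) (du x) (du a) (du b) (du c) (du d) h1 h2 h3 (u1 x).
have cd a b c : cof_diag (u s a) (u s b) (u s c) < 0 by exact: cof_diag_lt0.
have dE e x a b c d : det4 (u s e) (u s x) (u s a) (u s b) (u s c) (u s d)
    = gram_det (u s) -> det4 (u s e) (u s x) (u s a) (u s b) (u s c) (u s d) < 0.
  by move=> ->.
(* One formula serves all six edges: for each assignment of the labels it remains to identify the
   row of [x] in [cof_hess] with the coefficients of [is_derive_angle]. *)
have G e x a b c d (K := cof_hess (u s)) :
    det4 (u s e) (u s x) (u s a) (u s b) (u s c) (u s d) = gram_det (u s) ->
    [/\ K x x = hess_diag (u s e) (u s x) (u s a) (u s b) (u s c) (u s d), K x e = 1,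
      K x a = cof_off (u s c) (u s b) (u s e) (u s d) (u s a) (u s x)
              / cof_diag (u s a) (u s b) (u s x),
      K x b = cof_off (u s d) (u s a) (u s e) (u s c) (u s b) (u s x)
              / cof_diag (u s a) (u s b) (u s x) &
      K x c = cof_off (u s a) (u s d) (u s e) (u s b) (u s c) (u s x)
              / cof_diag (u s c) (u s d) (u s x) /\
      K x d = cof_off (u s b) (u s c) (u s e) (u s a) (u s d) (u s x)
              / cof_diag (u s c) (u s d) (u s x)] ->
  is_derive s 1
    (fun t => acos (cos_of (u t e) (u t x) (u t a) (u t b) (u t c) (u t d)))
    ((Num.sqrt (- gram_det (u s)))^-1 * sinh (l s x) *
     (K x e * sinh (l s e) * dl e + K x x * sinh (l s x) * dl x
      + K x a * sinh (l s a) * dl a + K x b * sinh (l s b) * dl b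
      + K x c * sinh (l s c) * dl c + K x d * sinh (l s d) * dl d)).
  move=> hd [-> -> -> -> [-> ->]].
  apply: (is_derive_eq (H _ _ _ _ _ _ (cd _ _ _) (cd _ _ _) _)); rewrite ?hd //.
  by rewrite sE /hess_diag; ring.
move: k mE; apply: ord6P => mE; rewrite /fcos /= big6;
  (apply: (is_derive_eq (G _ _ _ _ _ _ _ _));
   [by rewrite /gram_det /det4; ring
   |by do ?split; rewrite mxE //= /ecof /vcof /=; congr (_ / _);
       rewrite /cof_off /cof_diag; ring
   |by ring]).
Qed.

End AngleVariation.

(** * Symmetry, positivity and continuity of the Jacobian *)

Section AngleMatrixForm.
Variable R : realType.

Lemma tr_angle_mx (l : 'I_6 -> R) : (angle_mx l)^T = angle_mx l.
Proof.
apply/matrixP => k m; rewrite [LHS]mxE [LHS]mxE [RHS]mxE.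
have -> : hess (fcos (fun k => cosh (l k))) m k = hess (fcos (fun k => cosh (l k))) k m.
  by rewrite /hess -[in LHS]tr_edge_mx [LHS]mxE.
ring.
Qed.

Lemma angle_mx_posdef (l : 'I_6 -> R) (v : 'rV[R]_6) :
  (forall k, 0 < l k) -> gram_det (fun k => cosh (l k)) < 0 -> v != 0 ->
  0 < (v *m angle_mx l *m v^T) 0 0.
Proof.
move=> l0 D0; set u := fun k => cosh (l k) => vn0.
have u1 k : 1 < u k by exact: cosh_gt1.
pose w : 'rV[R]_6 := \row_k (v 0 k * sinh (l k) * escale u k).
have wE k : w 0 k = v 0 k * sinh (l k) * escale u k by rewrite mxE.
have s0 k : sinh (l k) * escale u k != 0.
  by rewrite gt_eqF // mulr_gt0 ?sinh_gt0 ?escale_gt0.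
have -> : (v *m angle_mx l *m v^T) 0 0 =
    (Num.sqrt (- gram_det u))^-1 * (w *m hess (fcos u) *m w^T) 0 0.
  rewrite !quadE mulr_sumr; apply: eq_bigr => j _; rewrite mulr_sumr.
  by apply: eq_bigr => i _; rewrite !wE [angle_mx _ _ _]mxE; ring.
rewrite mulr_gt0 ?invr_gt0 ?sqrtr_gt0 ?oppr_gt0 //.
apply: hess_posdef; first exact: hyp_links_fcos.
have /rV0Pn[k vk] := vn0.
by apply/rV0Pn; exists k; rewrite wE -mulrA mulf_neq0.
Qed.

Lemma cvg_cof_off (T : Type) (F : set_system T) (FF : Filter F)
    (e x a b c d : T -> R) el xl al bl cl dl :
  e t @[t --> F] --> el -> x t @[t --> F] --> xl -> a t @[t --> F] --> al ->
  b t @[t --> F] --> bl -> c t @[t --> F] --> cl -> d t @[t --> F] --> dl ->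
  cof_off (e t) (x t) (a t) (b t) (c t) (d t) @[t --> F] --> cof_off el xl al bl cl dl.
Proof.
move=> ce cx ca cb cc cd; rewrite /cof_off.
have cx2 : (1 - x t ^+ 2) @[t --> F] --> 1 - xl ^+ 2.
  by apply: cvgB; [exact: cvg_cst | exact: (cvgM cx cx)].
apply: cvgD; last by apply: (cvgM cx); apply: cvgD; [exact: (cvgM ca cd) | exact: (cvgM cb cc)].
apply: cvgD; last exact: (cvgM cb cd).
by apply: cvgD; [exact: (cvgM ce cx2) | exact: (cvgM ca cc)].
Qed.

Lemma cvg_cof_diag (T : Type) (F : set_system T) (FF : Filter F)
    (a b c : T -> R) al bl cl :
  a t @[t --> F] --> al -> b t @[t --> F] --> bl -> c t @[t --> F] --> cl ->
  cof_diag (a t) (b t) (c t) @[t --> F] --> cof_diag al bl cl.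
Proof.
move=> ca cb cc; rewrite /cof_diag.
apply: cvgB.
  apply: cvgB; last exact: (cvgM cc cc).
  apply: cvgB; last exact: (cvgM cb cb).
  by apply: cvgB; [exact: cvg_cst | exact: (cvgM ca ca)].
by apply: cvgM cc; apply: cvgM cb; apply: cvgM ca; exact: cvg_cst.
Qed.

Lemma cvg_sqrt (T : Type) (F : set_system T) (FF : Filter F) (f : T -> R) fl :
  f t @[t --> F] --> fl -> Num.sqrt (f t) @[t --> F] --> Num.sqrt fl.
Proof. by move=> cf; apply: (cvg_comp _ _ cf); exact: sqrt_continuous. Qed.

Lemma cvg_expR (T : Type) (F : set_system T) (FF : Filter F) (f : T -> R) fl :
  f t @[t --> F] --> fl -> expR (f t) @[t --> F] --> expR fl.
Proof. by move=> cf; apply: (cvg_comp _ _ cf); exact: continuous_expR. Qed.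

Variables (l : R -> 'I_6 -> R) (s : R).
Hypothesis cl : forall k, l t k @[t --> s] --> l s k.
Hypothesis l0 : forall k, 0 < l s k.
Let u t k := cosh (l t k).
Hypothesis D0 : gram_det (u s) < 0.

Let u1 k : 1 < u s k. Proof. exact: cosh_gt1. Qed.

Let cu k : u t k @[t --> s] --> u s k.
Proof.
apply: cvgM; last exact: cvg_cst.
by apply: cvgD; apply: cvg_expR; [|apply: cvgN]; exact: cl.
Qed.

Let csh k : sinh (l t k) @[t --> s] --> sinh (l s k).
Proof.
apply: cvgM; last exact: cvg_cst.
by apply: cvgB; apply: cvg_expR; [|apply: cvgN]; exact: cl.
Qed.

Let cvroot i : (i < 4)%N -> vroot (u t) i @[t --> s] --> vroot (u s) i.
Proof.
move=> i4; do 2![apply: cvg_sqrt]; apply: cvgN.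
by case: i i4 => [|[|[|[|//]]]] _; exact: cvg_cof_diag.
Qed.

Let cescale k : escale (u t) k @[t --> s] --> escale (u s) k.
Proof.
have cM i j (hi : (i < 4)%N) (hj : (j < 4)%N) :
    vroot (u t) i * vroot (u t) j @[t --> s] --> vroot (u s) i * vroot (u s) j.
  exact: cvgM (cvroot hi) (cvroot hj).
have n0 i j (hi : (i < 4)%N) (hj : (j < 4)%N) : vroot (u s) i * vroot (u s) j != 0.
  by rewrite mulf_neq0 // gt_eqF // vroot_gt0.
have c i j i' j' hi hj hi' hj' :=
  cvgM (cM i j hi hj) (cvgV (n0 i' j' hi' hj') (cM i' j' hi' hj')).
by move: k; apply: ord6P; exact: c.
Qed.

Let cfcos k : fcos (u t) k @[t --> s] --> fcos (u s) k.
Proof.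
have r a b c : Num.sqrt (- cof_diag (u s a) (u s b) (u s c)) != 0.
  by rewrite gt_eqF // sqrtr_gt0 oppr_gt0 cof_diag_lt0.
by move: k; apply: ord6P; rewrite /fcos /=; (apply: cvgM; first exact: cvg_cof_off);
  (apply: cvgV; first exact: mulf_neq0); apply: cvgM; apply: cvg_sqrt; apply: cvgN;
  exact: cvg_cof_diag.
Qed.

(** Continuity provides the bound on the coefficients needed for Gronwall's inequality. *)
Lemma cvg_angle_mx k m : angle_mx (l t) k m @[t --> s] --> angle_mx (l s) k m.
Proof.
have g := hyp_links_fcos u1 D0.
rewrite mxE; under eq_fun do rewrite mxE.
apply: cvgM.
  apply: cvgV; first by rewrite gt_eqF // sqrtr_gt0 oppr_gt0.
  apply: cvg_sqrt; apply: cvgN.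
  (* The identity of [cof_diag_off] expresses the determinant through cofactors with known limits,
     at all times near [s] where the length of 23 is positive. *)
  have x0 t : 0 < l t e23 -> 1 - u t e23 ^+ 2 != 0.
    by move=> lt0; have := cosh_gt1 lt0; rewrite -/(u t e23) => ?; rewrite lt_eqF //; nra.
  have dE t : 0 < l t e23 -> gram_det (u t) =
      (cof_diag (u t e12) (u t e13) (u t e23) * cof_diag (u t e02) (u t e03) (u t e23)
       - ecof (u t) e01 ^+ 2) / (1 - u t e23 ^+ 2).
    move=> /x0 h; rewrite /gram_det /cof_diag /ecof /= /cof_off /det4; field.
    exact: h.
  rewrite [X in _ --> X]dE //.
  have near0 := cvgr_gt (l s e23) (@cl e23) 0 (l0 e23).
  have H : (cof_diag (u t e12) (u t e13) (u t e23) * cof_diag (u t e02) (u t e03) (u t e23)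
      - ecof (u t) e01 ^+ 2) / (1 - u t e23 ^+ 2) @[t --> s] -->
      (cof_diag (u s e12) (u s e13) (u s e23) * cof_diag (u s e02) (u s e03) (u s e23)
      - ecof (u s) e01 ^+ 2) / (1 - u s e23 ^+ 2).
    apply: cvgM.
      apply: cvgB; first by apply: cvgM; exact: cvg_cof_diag.
      by apply: cvgM; exact: cvg_cof_off.
    apply: cvgV; first exact: x0.
    by apply: cvgB; [exact: cvg_cst | apply: cvgM; exact: cu].
  apply: cvg_trans H.
  by apply: near_eq_cvg; near=> t; apply/esym/dE; near: t; exact: near0.
apply: cvgM; last exact: csh.
apply: cvgM; first exact: csh.
apply: cvgM; last exact: cescale.
apply: cvgM; first exact: cescale.
apply: cvg_edge_mx => i; last exact: cfcos.
apply: cvgM; first exact: cvg_ewnum.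
apply: cvgV; first by rewrite gt_eqF // hyp_links_sqr.
apply: cvgB; first exact: cvg_cst.
by apply: cvgM; exact: cfcos.
Unshelve. all: by end_near.
Qed.

End AngleMatrixForm.

(** * Hyperideal tetrahedra *)

Section Minkowski.
Variable R : realType.
Implicit Types x y z w : 'rV[R]_4.

Lemma mdotE x y : mdot x y = - (x 0 v0 * y 0 v0) + x 0 v1 * y 0 v1
  + x 0 v2 * y 0 v2 + x 0 v3 * y 0 v3.
Proof.
rewrite /mdot !big_ord_recl big_ord0 addr0 !addrA.
by congr (- (_ * _) + _ * _ + _ * _ + _ * _); congr (_ 0 _); apply: val_inj.
Qed.

Lemma mdotC x y : mdot x y = mdot y x.
Proof. by rewrite !mdotE; ring. Qed.

Lemma mdotDl x y z : mdot (x + y) z = mdot x z + mdot y z.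
Proof. by rewrite !mdotE !mxE; ring. Qed.

Lemma mdotZl a x y : mdot (a *: x) y = a * mdot x y.
Proof. by rewrite !mdotE !mxE; ring. Qed.

Lemma mdotDr x y z : mdot x (y + z) = mdot x y + mdot x z.
Proof. by rewrite mdotC mdotDl !(mdotC x). Qed.

Lemma mdotZr a x y : mdot x (a *: y) = a * mdot x y.
Proof. by rewrite mdotC mdotZl mdotC. Qed.

Lemma mdot0l x : mdot 0 x = 0.
Proof. by rewrite mdotE !mxE; ring. Qed.

Lemma mdot_suml n (w : 'I_n -> R) (b : 'I_n -> 'rV[R]_4) x :
  mdot (\sum_i w i *: b i) x = \sum_i w i * mdot (b i) x.
Proof.
apply: (big_ind2 (fun y r => mdot y x = r)); first exact: mdot0l.
  by move=> y1 r1 y2 r2 <- <-; rewrite mdotDl.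
by move=> i _; rewrite mdotZl.
Qed.

Definition rows (b : 'I_4 -> 'rV[R]_4) : 'M[R]_4 := \matrix_(i, j) b i 0 j.

Definition lorentz : 'M[R]_4 :=
  diag_mx (\row_j (if j == v0 then -1 else 1)).

Lemma rows_mdot b c i j : (rows b *m lorentz *m (rows c)^T) i j = mdot (b i) (c j).
Proof.
by rewrite mul_mx_diag mxE big4 !mxE /= mdotE; ring.
Qed.

Lemma mdot_nondeg (b : 'I_4 -> 'rV[R]_4) x :
  (forall w : 'I_4 -> R, \sum_i w i *: b i = 0 -> forall i, w i = 0) ->
  (forall i, mdot (b i) x = 0) -> x = 0.
Proof.
move=> free bx.
have ub : rows b \in unitmx.
  rewrite unitmxE unitfE; apply/negP => /det0P[w wn0 wb].
  case/rV0Pn: wn0 => i; rewrite (free (w 0)) ?eqxx // => {i}.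
  apply/rowP => j; transitivity ((w *m rows b) 0 j); last by rewrite wb.
  by rewrite summxE mxE; apply: eq_bigr => i _; rewrite !mxE.
have h : rows b *m (lorentz *m x^T) = 0.
  apply/matrixP => i j; rewrite mulmxA [RHS]mxE -(bx i) [j]ord1.
  rewrite mul_mx_diag mxE big4 !mxE /= mdotE; ring.
have h' : lorentz *m x^T = 0 by rewrite -[LHS](mulKmx ub) h mulmx0.
apply/rowP => j; move/matrixP/(_ j 0): h'; rewrite mul_diag_mx !mxE.
by case: ifP => _; rewrite ?mulN1r ?mul1r // => /eqP; rewrite oppr_eq0 => /eqP.
Qed.

(* Writing x, y for the spatial parts,
   (x0 y0)^2 = (1 + x.y)^2 + |x - y|^2 + (|x|^2 |y|^2 - (x.y)^2). *)
Lemma H3_mdot x y : H3 x -> H3 y -> x != y -> mdot x y < -1.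
Proof.
rewrite /H3 /= => -[xx x0] [yy y0] xy.
have {}x0 : 0 < x 0 v0 by have -> : v0 = ord0 by apply: val_inj.
have {}y0 : 0 < y 0 v0 by have -> : v0 = ord0 by apply: val_inj.
move: xx yy; rewrite !mdotE => xx yy.
have S : 0 < (x 0 v1 - y 0 v1) ^+ 2 + (x 0 v2 - y 0 v2) ^+ 2
    + (x 0 v3 - y 0 v3) ^+ 2.
  rewrite lt_neqAle !addr_ge0 ?sqr_ge0 // andbT eq_sym.
  apply: contraNneq xy => /eqP.
  rewrite !paddr_eq0 ?addr_ge0 ?sqr_ge0 // !sqrf_eq0 !subr_eq0.
  move=> /andP[/andP[/eqP h1 /eqP h2] /eqP h3].
  have h0 : x 0 v0 = y 0 v0.
    have : (x 0 v0 - y 0 v0) * (x 0 v0 + y 0 v0) = 0.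
      by move: xx yy; rewrite h1 h2 h3 => xx yy; lra.
    move=> /eqP; rewrite mulf_eq0 subr_eq0 => /orP[/eqP //|/eqP]; lra.
  by apply/eqP/rowP; apply: ord4P.
move: (x 0 v0) (x 0 v1) (x 0 v2) (x 0 v3) (y 0 v0) (y 0 v1) (y 0 v2) (y 0 v3)
  x0 y0 xx yy S => a0 a1 a2 a3 b0 b1 b2 b3 a0_gt0 b0_gt0 aa bb S.
have t0 : 0 < a0 * b0 by exact: mulr_gt0.
have E : (a0 * b0) ^+ 2 = (1 + a1 * b1 + a2 * b2 + a3 * b3) ^+ 2
    + ((a1 - b1) ^+ 2 + (a2 - b2) ^+ 2 + (a3 - b3) ^+ 2)
    + ((a1 * b2 - a2 * b1) ^+ 2 + (a1 * b3 - a3 * b1) ^+ 2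
       + (a2 * b3 - a3 * b2) ^+ 2).
  rewrite exprMn (_ : a0 ^+ 2 = 1 + a1 ^+ 2 + a2 ^+ 2 + a3 ^+ 2).
    rewrite (_ : b0 ^+ 2 = 1 + b1 ^+ 2 + b2 ^+ 2 + b3 ^+ 2); first by ring.
    by rewrite !expr2; lra.
  by rewrite !expr2; lra.
have L : 0 <= (a1 * b2 - a2 * b1) ^+ 2 + (a1 * b3 - a3 * b1) ^+ 2
       + (a2 * b3 - a3 * b2) ^+ 2 by rewrite !addr_ge0 ?sqr_ge0.
suff : 1 + a1 * b1 + a2 * b2 + a3 * b3 < a0 * b0 by lra.
rewrite ltNge; apply/negP => le.
have : (a0 * b0) ^+ 2 <= (1 + a1 * b1 + a2 * b2 + a3 * b3) ^+ 2.
  by rewrite ler_pXn2r // nnegrE ?ltW // (lt_le_trans t0).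
by rewrite E; lra.
Qed.

End Minkowski.

Definition eset (k : 'I_6) : {set 'I_4} :=
  nth finset.set0 [:: [set v0; v1]; [set v0; v2]; [set v0; v3];
               [set v1; v2]; [set v1; v3]; [set v2; v3]]%SET k.

(** Links the list of [fcosE], indexed by edges, with the cofactor matrix, indexed by pairs of
    faces. *)
Lemma gcof_nth (F : realFieldType) (w : nat -> F) (u : 'I_6 -> F) k i j :
  i != j -> i \notin eset k -> j \notin eset k ->
  nth 0 [:: ecof u e23 / (w 2%N * w 3%N); ecof u e13 / (w 1%N * w 3%N);
            ecof u e12 / (w 1%N * w 2%N); ecof u e03 / (w 0%N * w 3%N);
            ecof u e02 / (w 0%N * w 2%N); ecof u e01 / (w 0%N * w 1%N)] k
  = gcof u i j / (w i * w j).
Proof.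
rewrite [gcof _ _ _]mxE.
move: (vcof u) (ecof u) => dg off.
move: k i j; apply: ord6P; do 2![apply: ord4P] => //= _;
  rewrite /eset !inE //= => _ _; by [|rewrite [X in _ / X = _]mulrC].
Qed.

(** * Endpoints of edges and Gram matrices of the normals *)

Section TruncatedVertices.
Variable R : realType.

Lemma bary_sum (y : 'rV[R]_3) : \sum_i bary y i = 1.
Proof.
have E (j : 'I_3) : bary y (lift ord0 j) = y 0 j.
  by rewrite /bary; case: unliftP => [i /lift_inj ->|/eqP].
by rewrite big_ord_recl (eq_bigr _ (fun j _ => E j)) /bary unlift_none subrK.
Qed.

Lemma bary_row (w : 'I_4 -> R) i : \sum_i w i = 1 ->
  bary (\row_j w (lift ord0 j)) i = w i.
Proof.
rewrite big_ord_recl /bary => w1; case: unliftP => [j ->|->]; first by rewrite mxE.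
by under eq_bigr do rewrite mxE; rewrite -w1 addrK.
Qed.

Lemma bary_two (y : 'rV[R]_3) (k l : 'I_4) : k != l ->
  (forall m, m != k -> m != l -> bary y m = 0) -> bary y k + bary y l = 1.
Proof.
move=> kl y0; rewrite -(bary_sum y) (bigD1 k) //= (bigD1 l) /= 1?eq_sym //.
by rewrite big1 ?addr0 // => m /andP[mk ml]; exact: y0.
Qed.

(** The point with weights 2/3 at [k] and 1/3 at [l]. *)
Lemma corner_point (k l : 'I_4) : k != l -> exists y : 'rV[R]_3,
  trunc_tri k y /\ forall m, m != k -> m != l -> trunc_hex m y.
Proof.
move=> kl; pose w i : R := if i == k then 2 / 3 else if i == l then 1 / 3 else 0.
have wk : w k = 2 / 3 by rewrite /w eqxx.
have wl : w l = 1 / 3 by rewrite /w eq_sym (negPf kl) eqxx.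
have w0 m : m != k -> m != l -> w m = 0 by rewrite /w => /negPf -> /negPf ->.
have w1 : \sum_i w i = 1.
  rewrite (bigD1 k) //= (bigD1 l) /= 1?eq_sym // big1 => [|m /andP[? ?]].
    by rewrite wk wl; field.
  exact: w0.
have tt : trunc_tet (\row_j w (lift ord0 j)).
  move=> i; rewrite bary_row // /w.
  by case: ifP => _; [|case: ifP => _]; apply/andP; split; lra.
exists (\row_j w (lift ord0 j)); split=> [|m mk ml]; split=> //=.
  by rewrite bary_row.
by rewrite bary_row // w0.
Qed.

Lemma hchartE (x : 'rV[R]_4) : H3 x -> hchart (\row_j x 0 (lift ord0 j)) = x.
Proof.
move=> [xx x0]; apply/rowP => i; rewrite mxE; case: unliftP => [j ->|->].
  by rewrite mxE.
under eq_bigr do rewrite mxE.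
suff -> : 1 + \sum_(j < 3) x 0 (lift ord0 j) ^+ 2 = x 0 ord0 ^+ 2.
  by rewrite sqrtr_sqr gtr0_norm.
move: xx; rewrite /mdot; under eq_bigr do rewrite -expr2.
by rewrite -expr2 => /eqP; rewrite addrC subr_eq addrC => /eqP ->; ring.
Qed.

Variable Q : marked_polyhedron R.
Hypothesis hQ : hyperideal Q.

Local Notation v := (vtx Q).

Let chart_image (S : set 'rV[R]_4) (x : 'rV[R]_4) : S `<=` body Q -> S x ->
  (hchart @^-1` S) (\row_j x 0 (lift ord0 j)).
Proof. by move=> SQ Sx; rewrite /= hchartE //; case: (SQ _ Sx). Qed.

(** The diffeomorphism pulls a corner of the truncated tetrahedron back to this intersection, so the
    choice in [vtx] is not a default value. *)
Lemma vtxP k l : k != l -> (triF Q k `&` edgeF Q k l) (v k l).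
Proof.
move=> kl; apply: (@getPex _ (triF Q k `&` edgeF Q k l)).
have [_ _ [U [V [f [g [[_ _ _ fK _] sU _ fF]]]]] _] := hQ.
have [y [yk ym]] := corner_point kl.
have [p pk fp] : (f @` (hchart @^-1` triF Q k)) y by rewrite (fF k).2.
exists (hchart p); split=> // m /= [mk ml].
have [p' pm fp'] : (f @` (hchart @^-1` hexF Q m)) y by rewrite (fF m).1; exact: ym.
(* Each face gives its own preimage of the corner; injectivity of [f] identifies them. *)
suff -> : p = p' by [].
have Up : U p by apply: sU; exact: pk.1.
have Up' : U p' by apply: sU; exact: pm.1.
by rewrite -(fK p Up) fp -fp' fK.
Qed.

(** The image of the endpoint has barycentric coordinates 2/3 at [k] and 1/3 at [l], so it avoids
    the images of these three faces. *)
Lemma vtx_strict k l : k != l ->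
  [/\ mdot (v k l) (hexN Q k) < 0, mdot (v k l) (hexN Q l) < 0 &
      mdot (v k l) (triN Q l) < 0].
Proof.
move=> kl; have [[vB vk] vE] := vtxP kl.
have [_ _ [U [V [f [g [[_ _ _ fK _] sU _ fF]]]]] _] := hQ.
pose p := \row_j (v k l) 0 (lift ord0 j); pose y := f p.
have inF (S : set 'rV[R]_4) : S `<=` body Q -> S (v k l) ->
    (f @` (hchart @^-1` S)) y.
  by move=> SQ Sv; exists p => //; exact: chart_image.
have triS m : triF Q m `<=` body Q by move=> x [].
have hexS m : hexF Q m `<=` body Q by move=> x [].
have yk : bary y k = 2 / 3.
  by have := inF _ (@triS k) (conj vB vk); rewrite (fF k).2 => -[].
have ym m : hexF Q m (v k l) -> bary y m = 0.
  by move=> /(inF _ (@hexS m)); rewrite (fF m).1 => -[].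
have yl : bary y l = 1 / 3.
  suff : bary y k + bary y l = 1 by rewrite yk; lra.
  by apply: bary_two => // m mk ml; apply/ym/vE.
have [_ neg] := vB; split; rewrite lt_neqAle.
- rewrite (neg k).1 andbT; apply/eqP => v0.
  by have := ym k (conj vB v0); rewrite yk; lra.
- rewrite (neg l).1 andbT; apply/eqP => v0.
  by have := ym l (conj vB v0); rewrite yl; lra.
- rewrite (neg l).2 andbT; apply/eqP => v0.
  have := inF _ (@triS l) (conj vB v0); rewrite (fF l).2 => -[_ /=].
  by rewrite yl; lra.
Qed.

Lemma vtx_incident k l : k != l ->
  [/\ H3 (v k l), mdot (v k l) (triN Q k) = 0 &
      forall m, m != k -> m != l -> mdot (v k l) (hexN Q m) = 0].
Proof.
move=> kl; have [[[vH _] vk] vE] := vtxP kl.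
by split=> // m mk ml; have [] := vE m (conj mk ml).
Qed.

Lemma vtx_neq k l j : k != l -> k != j -> j != l ->
  v k l != v l k /\ v k l != v k j.
Proof.
move=> kl kj jl; have lk : l != k by rewrite eq_sym.
have [_ _ s1] := vtx_strict lk; have [_ t1 _] := vtx_incident kl.
have [_ s2 _] := vtx_strict kl; have [_ _ t2] := vtx_incident kj.
split; apply/eqP => E.
  by move: s1; rewrite -E t1 ltxx.
by move: s2; rewrite E t2 1?eq_sym // ltxx.
Qed.

Lemma hdir_norm x y : H3 x -> mdot (hdir x y) (hdir x y) = mdot y y + mdot x y ^+ 2 :> R.
Proof.
move=> [xx _]; rewrite /hdir !(mdotDl, mdotDr, mdotZl, mdotZr) xx (mdotC y x).
ring.
Qed.

Lemma vtx_right_angle j k l : uniq [:: j; k; l] ->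
  mdot (hdir (v k l) (v l k)) (hdir (v k l) (v k j)) = 0.
Proof.
move=> jkl; have [_ _ _ /(_ j k l jkl)] := hQ.
move: jkl; rewrite /= !inE negb_or => /andP[/andP[jk jl] /andP[kl _]].
have lk : l != k by rewrite eq_sym.
have kj : k != j by rewrite eq_sym.
have [n1 n2] := vtx_neq kl kj jl.
have [hkl _ _] := vtx_incident kl; have [hlk _ _] := vtx_incident lk.
have [hkj _ _] := vtx_incident kj.
have m1 := H3_mdot hkl hlk n1; have m2 := H3_mdot hkl hkj n2.
have g1 : 0 < mdot (hdir (v k l) (v l k)) (hdir (v k l) (v l k)).
  by rewrite hdir_norm //; case: hlk => -> _; nra.
have g2 : 0 < mdot (hdir (v k l) (v k j)) (hdir (v k l) (v k j)).
  by rewrite hdir_norm //; case: hkj => -> _; nra.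
rewrite /hangle; set a := mdot _ _ / _ => acos_a.
have : a = 0.
  (* Outside its domain [acos] takes the default value 0, so the value [pi / 2] is a genuine
     arccosine. *)
  have p20 : pi / 2 != 0 :> R by rewrite gt_eqF // divr_gt0 // pi_gt0.
  move: acos_a; rewrite unlock /acos.body.
  case: xgetP => [y _ [_ <-] ->|_ /esym/eqP]; last by rewrite (negPf p20).
  by rewrite cos_pihalf.
rewrite /a => /eqP; rewrite mulf_eq0 invr_eq0 mulf_eq0 !sqrtr_eq0.
by rewrite !leNgt g1 g2 !orbF => /eqP.
Qed.

(* The edge direction at the endpoint [v k l] is orthogonal to the three
   vertices of the triangle k, hence proportional to its normal. *)
Lemma edge_direction k l : k != l -> exists2 c : R, c < 0 &
  v l k + mdot (v k l) (v l k) *: v k l = c *: triN Q k.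
Proof.
move=> kl; have lk : l != k by rewrite eq_sym.
have [hkl tkl _] := vtx_incident kl.
have Tk : 0 < mdot (triN Q k) (triN Q k) by have [/(_ k)[]] := hQ.
set t := v l k + _; have tE : t = hdir (v k l) (v l k) by rewrite /hdir mdotC.
have [_ _ slk] := vtx_strict lk.
have tT : mdot t (triN Q k) < 0 by rewrite mdotDl mdotZl tkl mulr0 addr0.
have vv : mdot (v k l) (v k l) = -1 by case: hkl.
have t_vkl : mdot t (v k l) = 0.
  by rewrite mdotDl mdotZl vv (mdotC (v l k)); ring.
have t_v m : m != k -> mdot t (v k m) = 0.
  move=> mk; have [->//|ml] := eqVneq m l.
  have := @vtx_right_angle m k l; rewrite /= !inE negb_or mk ml kl => /(_ isT).
  by rewrite -tE {1}/hdir mdotDr mdotZr t_vkl mulr0 addr0.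
pose c := mdot t (triN Q k) / mdot (triN Q k) (triN Q k).
exists c; first by rewrite pmulr_llt0 ?invr_gt0.
apply/eqP; rewrite -subr_eq0; apply/eqP.
(* These four vectors are independent: pairing a relation with [triN Q k] and then with each
   [hexN Q m] isolates its coefficients. *)
pose b m := if m == k then triN Q k else v k m.
apply: (@mdot_nondeg _ b) => [w w0|m]; last first.
  rewrite /b mdotDr -scaleNr mdotZr; case: (eqVneq m k) => [_|mk].
    by rewrite /c mdotC; field; rewrite gt_eqF.
  have km : k != m by rewrite eq_sym.
  have [_ -> _] := vtx_incident km.
  by rewrite mdotC t_v // mulr0 addr0.
have wdot x : \sum_m w m * mdot (b m) x = 0 by rewrite -mdot_suml w0 mdot0l.
have wk : w k = 0.
  have := wdot (triN Q k); rewrite (bigD1 k) //= big1 => [|m mk].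
    by rewrite addr0 /b eqxx => /eqP; rewrite mulf_eq0 (gt_eqF Tk) orbF => /eqP.
  have km : k != m by rewrite eq_sym.
  by rewrite /b (negPf mk); have [_ -> _] := vtx_incident km; rewrite mulr0.
move=> m; have [->//|mk] := eqVneq m k.
have km : k != m by rewrite eq_sym.
have := wdot (hexN Q m); rewrite (bigD1 m) //= big1 => [|m' mm'].
  have [_ sm _] := vtx_strict km.
  by rewrite addr0 /b (negPf mk) => /eqP; rewrite mulf_eq0 (lt_eqF sm) orbF => /eqP.
have [->|m'k] := eqVneq m' k; first by rewrite wk mul0r.
have km' : k != m' by rewrite eq_sym.
have [_ _ h] := vtx_incident km'.
by rewrite /b (negPf m'k) h ?mulr0 // eq_sym.
Qed.

(** For [l] different from both, the edge kl lies in the hexagon m, and its direction at the end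
    near k is a multiple of [triN Q k]. *)
Lemma triN_hexN k m : m != k -> mdot (triN Q k) (hexN Q m) = 0.
Proof.
move=> mk; have [l /andP[lk lm]] : exists l, (l != k) && (l != m).
  by move: k m {mk}; do 2![apply: ord4P];
    first [by exists v0 | by exists v1 | by exists v2 | by exists v3].
have kl : k != l by rewrite eq_sym.
have ml : m != l by rewrite eq_sym.
have [c c0 E] := edge_direction kl.
have [_ _ h1] := vtx_incident kl; have [_ _ h2] := vtx_incident lk.
have := congr1 (fun x => mdot x (hexN Q m)) E.
rewrite mdotDl !mdotZl h1 // h2 // mulr0 addr0 => /esym/eqP.
by rewrite mulf_eq0 (lt_eqF c0) => /eqP.
Qed.

Lemma triN_hexN_lt0 k : mdot (triN Q k) (hexN Q k) < 0.
Proof.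
have [l lk] : exists l, l != k.
  by move: k; apply: ord4P; first [by exists v0 | by exists v1].
have kl : k != l by rewrite eq_sym.
have [c c0 E] := edge_direction kl; have [c' _ E'] := edge_direction lk.
have [s1 _ _] := vtx_strict kl; have [_ s2 _] := vtx_strict lk.
have [h1 _ _] := vtx_incident kl; have [h2 _ _] := vtx_incident lk.
have := congr1 (fun x => mdot x (hexN Q k)) E.
have := congr1 (fun x => mdot x (hexN Q k)) E'.
have [j /andP[jk jl]] : exists j, (j != k) && (j != l).
  by move: k l {kl lk c c0 E c' E' s1 s2 h1 h2}; do 2![apply: ord4P];
    first [by exists v0 | by exists v1 | by exists v2 | by exists v3].
have kj : k != j by rewrite eq_sym.
have [ne _] := vtx_neq kl kj jl.
have := H3_mdot h1 h2 ne; rewrite (mdotC (v l k)).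
rewrite !mdotDl !mdotZl triN_hexN // mulr0.
set mu := mdot _ _; set al := mdot (v l k) _ in s2 *; set be := mdot (v k l) _ in s1 *.
move=> mu1 eqn1 eqn2.
(* The edge direction at the other end is orthogonal to [hexN Q k]. *)
have bE : be = - mu * al by lra.
have : 0 < c * mdot (triN Q k) (hexN Q k).
  rewrite -eqn2 bE (_ : _ + _ = - al * (mu ^+ 2 - 1)); last by ring.
  by rewrite mulr_gt0 ?oppr_gt0 //; nra.
by rewrite nmulr_rgt0.
Qed.

Variable len : {set 'I_4} -> R.
Hypothesis hlen : has_lengths Q len.
Hypothesis len_gt0 : forall e, 0 < len e.

(** Both normals are negative multiples of the edge directions at the two ends; these have squared
    norm [mu ^+ 2 - 1] and product [mu * (mu ^+ 2 - 1)], where [- mu] is the cosh of the length. *)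
Lemma triN_cosh k l : k != l -> mdot (triN Q k) (triN Q l) =
  - cosh (len [set k; l]%SET) * (Num.sqrt (mdot (triN Q k) (triN Q k))
                            * Num.sqrt (mdot (triN Q l) (triN Q l))).
Proof.
move=> kl; have lk : l != k by rewrite eq_sym.
have [c c0 E] := edge_direction kl; have [c' c'0 E'] := edge_direction lk.
have [h1 _ _] := vtx_incident kl; have [h2 _ _] := vtx_incident lk.
have [j /andP[jk jl]] : exists j, (j != k) && (j != l).
  by move: k l {kl lk c c0 E c' c'0 E' h1 h2}; do 2![apply: ord4P];
    first [by exists v0 | by exists v1 | by exists v2 | by exists v3].
have kj : k != j by rewrite eq_sym.
have [ne _] := vtx_neq kl kj jl.
have := H3_mdot h1 h2 ne; rewrite (mdotC (v l k)) in E'.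
have := hlen kl; rewrite /edge_length /hdist.
have vv1 : mdot (v k l) (v k l) = -1 by case: h1.
have vv2 : mdot (v l k) (v l k) = -1 by case: h2.
set mu := mdot (v k l) (v l k) in E E' *; move=> lenE mu1.
have m2 : 0 < mu ^+ 2 - 1 by nra.
have vv3 : mdot (v l k) (v k l) = mu by rewrite mdotC.
have Tk : c ^+ 2 * mdot (triN Q k) (triN Q k) = mu ^+ 2 - 1.
  rewrite expr2 -mulrA -mdotZr -mdotZl -E !(mdotDl, mdotDr, mdotZl, mdotZr).
  by rewrite vv1 vv2 vv3 -/mu; ring.
have Tl : c' ^+ 2 * mdot (triN Q l) (triN Q l) = mu ^+ 2 - 1.
  rewrite expr2 -mulrA -mdotZr -mdotZl -E' !(mdotDl, mdotDr, mdotZl, mdotZr).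
  by rewrite vv1 vv2 vv3 -/mu; ring.
have Tkl : c * c' * mdot (triN Q k) (triN Q l) = mu * (mu ^+ 2 - 1).
  rewrite -mulrA -mdotZr -mdotZl -E -E' !(mdotDl, mdotDr, mdotZl, mdotZr).
  by rewrite vv1 vv2 vv3 -/mu; ring.
have r0 : 0 < Num.sqrt (mu ^+ 2 - 1) by rewrite sqrtr_gt0.
have rE : Num.sqrt (mu ^+ 2 - 1) ^+ 2 = mu ^+ 2 - 1 by rewrite sqr_sqrtr // ltW.
have sk : Num.sqrt (mdot (triN Q k) (triN Q k)) = - Num.sqrt (mu ^+ 2 - 1) / c.
  by rewrite -Tk sqrtrM ?sqr_ge0 // sqrtr_sqr ltr0_norm //; field; rewrite lt_eqF.
have sl : Num.sqrt (mdot (triN Q l) (triN Q l)) = - Num.sqrt (mu ^+ 2 - 1) / c'.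
  by rewrite -Tl sqrtrM ?sqr_ge0 // sqrtr_sqr ltr0_norm //; field; rewrite lt_eqF.
have -> : cosh (len [set k; l]%SET) = - mu.
  have zp : 0 < - mu + Num.sqrt (mu ^+ 2 - 1) by lra.
  rewrite /cosh -lenE sqrrN expRN lnK ?posrE //.
  move: r0 rE zp; move: (Num.sqrt _) => r r0 rE zp.
  have -> : (- mu + r)^-1 = - mu - r.
    apply: (mulfI (lt0r_neq0 zp)); rewrite divff ?lt0r_neq0 //.
    by rewrite (_ : _ * _ = mu ^+ 2 - r ^+ 2); [rewrite rE; ring | ring].
  by field.
rewrite sk sl opprK.
have cc : c * c' != 0 by rewrite mulf_neq0 // lt_eqF.
apply: (mulfI cc); rewrite Tkl -[in LHS]rE; field.
by rewrite !lt_eqF.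
Qed.

Let u k := cosh (len (eset k)).

(** The hexagon normals form the dual basis of the unit normals [T] up to the diagonal factor [D],
    so their Gram matrix is the inverse of [gram u] between two copies of [D]. *)
Lemma hexN_gram (T := fun k => (Num.sqrt (mdot (triN Q k) (triN Q k)))^-1 *: triN Q k)
    i j : gram_det u * mdot (hexN Q i) (hexN Q j) =
  mdot (T i) (hexN Q i) * gcof u i j * mdot (T j) (hexN Q j).
Proof.
have q0 k : 0 < Num.sqrt (mdot (triN Q k) (triN Q k)).
  by rewrite sqrtr_gt0; have [/(_ k)[]] := hQ.
pose n k := mdot (T k) (hexN Q k).
have n0 k : n k != 0.
  by rewrite lt_eqF // /n /T mdotZl pmulr_rlt0 ?invr_gt0 // triN_hexN_lt0.
pose D := diag_mx (\row_k n k); pose D' := diag_mx (\row_k (n k)^-1).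
have DD' : D *m D' = 1%:M.
  apply/matrixP => a b; rewrite mul_diag_mx !mxE.
  by case: (a == b); rewrite ?mulr0 // !mulr1n divff.
have H : rows T *m lorentz R *m (rows T)^T = gram u.
  apply/matrixP => a b; rewrite rows_mdot /T mdotZl mdotZr.
  have [->|ab] := eqVneq a b.
    rewrite (_ : gram u b b = 1); last by move: b; apply: ord4P; rewrite mxE.
    have -> : mdot (triN Q b) (triN Q b) = Num.sqrt (mdot (triN Q b) (triN Q b)) ^+ 2.
      by rewrite sqr_sqrtr // ltW //; have [/(_ b)[]] := hQ.
    by rewrite sqrtr_sqr gtr0_norm //; field; rewrite gt_eqF.
  rewrite (triN_cosh ab) (_ : gram u a b = - cosh (len [set a; b]%SET)).
    by field; rewrite !gt_eqF.
  move: a b ab; do 2![apply: ord4P] => //= _; rewrite mxE /= /u /eset /= //;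
    by rewrite finset.setUC.
have X : rows T *m lorentz R *m (rows (hexN Q))^T = D.
  apply/matrixP => a b; rewrite rows_mdot [RHS]mxE [in RHS]mxE.
  have [->|ab] := eqVneq a b; first by rewrite mulr1n.
  by rewrite mulr0n mdotZl triN_hexN ?mulr0 // eq_sym.
have Y : rows (hexN Q) *m lorentz R *m (rows T)^T = D.
  apply/matrixP => a b; rewrite rows_mdot mdotC -rows_mdot X.
  by rewrite /D -[in LHS]tr_diag_mx [LHS]mxE.
have inv : (rows (hexN Q))^T *m D' *m (rows T *m lorentz R) = 1%:M.
  by apply: mulmx1C; rewrite mulmxA X.
have Z : rows (hexN Q) *m lorentz R *m (rows (hexN Q))^T *m D' *m gram u = D.
  rewrite -H -Y !mulmxA; congr (_ *m _).
  by rewrite -[RHS]mulmx1 -inv !mulmxA.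
have W : rows (hexN Q) *m lorentz R *m (rows (hexN Q))^T *m D' *m (gram_det u)%:M
    = D *m gcof u by rewrite -mul_gram_gcof mulmxA Z.
have := congr1 (fun A : 'M[R]_4 => A i j) W.
rewrite mul_mx_scalar mxE mul_mx_diag mul_diag_mx mxE rows_mdot mxE [in RHS]mxE.
rewrite mxE => W'; rewrite -/(n i) -/(n j) -W'.
by field.
Qed.

Let u1 k : 1 < u k. Proof. exact: cosh_gt1. Qed.

(** In [hexN_gram] at a diagonal entry, the normal has positive square while the vertex cofactor is
    negative. *)
Lemma gram_det_lt0 : gram_det u < 0.
Proof.
have N0 : 0 < mdot (hexN Q v0) (hexN Q v0) by have [/(_ v0)[]] := hQ.
have n0 : 0 < Num.sqrt (mdot (triN Q v0) (triN Q v0)).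
  by rewrite sqrtr_gt0; have [/(_ v0)[]] := hQ.
rewrite -(pmulr_llt0 _ N0) hexN_gram mulrAC.
rewrite nmulr_llt0; last by rewrite mxE /= vcof_lt0.
rewrite -expr2 exprn_even_gt0 //= mdotZl; apply: mulf_neq0.
  by rewrite invr_eq0 gt_eqF.
by rewrite lt_eqF // triN_hexN_lt0.
Qed.

Lemma dihedralE i j : dihedral Q i j = acos (gcof u i j /
  (Num.sqrt (- vcof u i) * Num.sqrt (- vcof u j))).
Proof.
have D0 := gram_det_lt0.
have [n nE n0] : exists2 n : 'I_4 -> R, forall i j,
    gram_det u * mdot (hexN Q i) (hexN Q j) = n i * gcof u i j * n j &
    forall i, n i < 0.
  eexists; first exact: hexN_gram.
  move=> k /=; rewrite mdotZl pmulr_rlt0 ?invr_gt0 ?triN_hexN_lt0 //.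
  by rewrite sqrtr_gt0; have [/(_ k)[]] := hQ.
have d0 : 0 < Num.sqrt (- gram_det u) by rewrite sqrtr_gt0 oppr_gt0.
have NE a b : mdot (hexN Q a) (hexN Q b) = n a * gcof u a b * n b / gram_det u.
  by rewrite -nE; field; rewrite lt_eqF.
have gE k : gcof u k k = vcof u k by move: k; apply: ord4P; rewrite mxE.
have sE k : Num.sqrt (mdot (hexN Q k) (hexN Q k)) =
    - n k * Num.sqrt (- vcof u k) / Num.sqrt (- gram_det u).
  rewrite NE gE (_ : _ / _ = n k ^+ 2 * (- vcof u k / - gram_det u)); last first.
    by field; rewrite lt_eqF // oppr_eq0 lt_eqF.
  rewrite sqrtrM ?sqr_ge0 // sqrtr_sqr ltr0_norm // sqrtrM; last first.
    by rewrite oppr_ge0 ltW // vcof_lt0.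
  by rewrite sqrtrV ?oppr_ge0 ?ltW // mulrA.
have dE : gram_det u = - Num.sqrt (- gram_det u) ^+ 2.
  by rewrite sqr_sqrtr ?opprK // oppr_ge0 ltW.
rewrite /dihedral; congr acos; rewrite !sE NE.
have r (k : 'I_4) : Num.sqrt (- vcof u k) != 0 by rewrite gt_eqF // sqrtr_gt0 oppr_gt0 vcof_lt0.
move: dE d0; move: (Num.sqrt (- gram_det u)) => d dE d0; rewrite dE.
by field; rewrite !r !(lt_eqF (n0 _)) gt_eqF.
Qed.

Lemma dihedral_fcos k i j : i != j -> eset k = (~: [set i; j])%SET ->
  dihedral Q i j = acos (fcos u k).
Proof.
move=> ij E; rewrite dihedralE; congr acos.
have iE : i \notin eset k by rewrite E !inE eqxx.
have jE : j \notin eset k by rewrite E !inE eqxx orbT.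
rewrite fcosE //; move: (gcof_nth (fun l => Num.sqrt (- vcof u l)) u ij iE jE).
by rewrite !vroot2 => ->.
Qed.

End TruncatedVertices.

(** * The curvature flow *)

Section EdgeSums.

Lemma eset_inj : injective eset.
Proof.
move=> k m /finset.setP E.
have E0 := E v0; have E1 := E v1; have E2 := E v2; have E3 := E v3.
move: k m E0 E1 E2 E3 {E}; do 2![apply: ord6P] => //;
  by rewrite /eset !inE.
Qed.

Lemma card_eset k : #|eset k| = 2%N.
Proof. by move: k; apply: ord6P; rewrite /eset /= cards2. Qed.

Lemma esetP (e : {set 'I_4}) : #|e| = 2%N -> exists k, e = eset k.
Proof.
move=> /eqP/cards2P[x [y [xy ->]]]; move: x y xy.
do 2![apply: ord4P] => //= _; first [by exists e01 | by exists e02 | by exists e03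
  | by exists e12 | by exists e13 | by exists e23
  | by exists e01; rewrite finset.setUC | by exists e02; rewrite finset.setUC
  | by exists e03; rewrite finset.setUC | by exists e12; rewrite finset.setUC
  | by exists e13; rewrite finset.setUC | by exists e23; rewrite finset.setUC].
Qed.

Lemma sum_edges (V : nmodType) (P : pred {set 'I_4}) (F : {set 'I_4} -> V) :
  \sum_(e : {set 'I_4} | (#|e| == 2%N) && P e) F e = \sum_(k | P (eset k)) F (eset k).
Proof.
rewrite big_mkcondr [RHS]big_mkcond /=.
rewrite (eq_bigl (mem (eset @: [set: 'I_6])%SET)) => [|e].
  rewrite big_imset; last by move=> k m _ _; exact: eset_inj.
  by apply: eq_bigl => k; rewrite inE.
apply/eqP/imsetP => [/esetP[k ->]|[k _ ->]]; last exact: card_eset.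
by exists k.
Qed.

Lemma eset_compl k : exists i j, i != j /\ eset k = (~: [set i; j])%SET.
Proof.
have E : forall i j : 'I_4, (forall x, (x \in eset k) = (x != i) && (x != j)) ->
    eset k = (~: [set i; j])%SET.
  by move=> i j h; apply/finset.setP => x; rewrite h !inE negb_or.
move: k E; apply: ord6P => E; [exists v2, v3|exists v1, v3|exists v1, v2
  |exists v0, v3|exists v0, v2|exists v0, v1]; split=> //; apply: E;
  by apply: ord4P; rewrite !inE.
Qed.

End EdgeSums.

(** * Angles as functions of lengths alone *)

Section Angles.
Variable R : realType.

(** Every tetrahedron with these lengths yields the same explicit angle, so the choice made by [get]
    does not matter. *)
Lemma angle_of_lengthsE (len : {set 'I_4} -> R) k :
  (exists Q, hyperideal Q /\ has_lengths Q len) -> (forall e, 0 < len e) ->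
  angle_of_lengths len (eset k) = acos (fcos (fun m => cosh (len (eset m))) k).
Proof.
move=> [Q [hQ lQ]] len0; have [i [j [ij E]]] := eset_compl k.
rewrite /angle_of_lengths; set S := [set th | _].
have [|Q' [i' [j' [hQ' lQ' ij' E' ->]]]] := @getPex R S.
  by exists (dihedral Q i j), Q, i, j.
exact: dihedral_fcos.
Qed.

End Angles.

(** * The curvature matrix and the heat equation *)

Section CurvatureFlow.
Variables (R : realType) (T : finType) (n : nat).
Variable lab : T -> {set 'I_4} -> 'I_n.
Implicit Types x : 'rV[R]_n.

Definition edge_lengths x t (k : 'I_6) : R := tet_lengths lab x t (eset k).

Definition incidence t : 'M[R]_(6, n) := \matrix_(k, i) (lab t (eset k) == i)%:R.

(** Incidence matrices assemble the Jacobians, counting identified edges of a tetrahedron with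
    multiplicity; the sign is that of the angles in the curvature. *)
Definition curv_mx x : 'M[R]_n :=
  - \sum_t (incidence t)^T *m angle_mx (edge_lengths x t) *m incidence t.

Lemma tr_curv_mx x : (curv_mx x)^T = curv_mx x.
Proof.
rewrite /curv_mx linearN /= linear_sum /=; congr (- _); apply: eq_bigr => t _.
by rewrite !trmx_mul trmxK tr_angle_mx mulmxA.
Qed.

Lemma row_incidence (v : 'rV[R]_n) t k : (v *m (incidence t)^T) 0 k = v 0 (lab t (eset k)).
Proof.
rewrite mxE (bigD1 (lab t (eset k))) //= big1 => [|i ni].
  by rewrite !mxE eqxx mulr1 addr0.
by rewrite !mxE eq_sym (negPf ni) mulr0.
Qed.

Lemma cone_metric_tet x t : cone_metric lab x ->
  [/\ forall e, 0 < tet_lengths lab x t e,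
      exists Q, hyperideal Q /\ has_lengths Q (tet_lengths lab x t) &
      gram_det (fun k => cosh (edge_lengths x t k)) < 0].
Proof.
move=> [x0 /(_ t)[Q [hQ lQ]]]; have l0 e : 0 < tet_lengths lab x t e by exact: x0.
split=> //; first by exists Q.
exact: gram_det_lt0 hQ _ lQ l0.
Qed.

Lemma curvatureE x i : cone_metric lab x ->
  curvature lab x i = 2 * pi - \sum_t \sum_k (lab t (eset k) == i)%:R *
    acos (fcos (fun m => cosh (edge_lengths x t m)) k).
Proof.
move=> hx; rewrite /curvature; congr (_ - _); apply: eq_bigr => t _.
have [l0 Q _] := cone_metric_tet t hx.
rewrite sum_edges big_mkcond; apply: eq_bigr => k _.
by case: ifP => _; rewrite ?mul0r // mul1r angle_of_lengthsE.
Qed.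

(** Every edge occurs in some tetrahedron, so a nonzero [v] restricts to a nonzero vector on at
    least one of them; the other terms are nonnegative. *)
Lemma curv_mx_negdef x : (forall i, exists t (e : {set 'I_4}), #|e| = 2%N /\ lab t e = i) ->
  cone_metric lab x -> negative_definite (curv_mx x).
Proof.
move=> lab_surj hx v vn0.
rewrite /curv_mx mulmxN mulNmx mxE oppr_lt0 mulmx_sumr mulmx_suml summxE.
pose w t := v *m (incidence t)^T.
have E t : (v *m ((incidence t)^T *m angle_mx (edge_lengths x t) *m incidence t) *m v^T) 0 0
    = (w t *m angle_mx (edge_lengths x t) *m (w t)^T) 0 0.
  by rewrite /w trmx_mul trmxK !mulmxA.
have pd t : w t != 0 -> 0 < (w t *m angle_mx (edge_lengths x t) *m (w t)^T) 0 0.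
  by have [l0 _ D0] := cone_metric_tet t hx; apply: angle_mx_posdef => // k; exact: l0.
under eq_bigr do rewrite E.
have /rV0Pn[i vi] := vn0; have [t [e [e2 te]]] := lab_surj i.
have [k ek] := esetP e2.
rewrite (bigD1 t) //= ltr_pwDl //.
  by apply: pd; apply/rV0Pn; exists k; rewrite row_incidence -ek te.
apply: sumr_ge0 => t' _; have [->|wn0] := eqVneq (w t') 0.
  by rewrite !mul0mx mxE.
exact/ltW/pd.
Qed.

Lemma is_derive_sumr (I : finType) (F : I -> R -> R) (dF : I -> R) (s : R) :
  (forall i, is_derive s 1 (F i) (dF i)) ->
  is_derive s 1 (fun r => \sum_i F i r) (\sum_i dF i).
Proof.
move=> dFi; elim: (index_enum I) => [|i r IH].
  rewrite big_nil; under eq_fun do rewrite big_nil; exact: is_derive_constf.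
rewrite big_cons; under eq_fun do rewrite big_cons; exact: is_derive_addf.
Qed.

Lemma is_derive_curvature (J : set R) (x : R -> 'rV[R]_n) : open J ->
  curvature_flow lab J x -> forall s, J s -> forall i,
  is_derive s 1 (fun r => curvature lab (x r) i)
    (\sum_j curv_mx (x s) i j * curvature lab (x s) j).
Proof.
move=> oJ flow s Js i.
have [hx dx] := flow s Js.
pose K := \row_j curvature lab (x s) j.
pose f r := 2 * pi - \sum_t \sum_k (lab t (eset k) == i)%:R *
    acos (fcos (fun m => cosh (edge_lengths (x r) t m)) k).
(* The explicit formula holds only at cone metrics, hence at all times near [s] because [J] is
   open. *)
apply: (near_eq_is_derive (f := f)).
  have : \forall r \near s, J r by exact: open_nbhs_nbhs.
  by apply: filterS => r Jr; rewrite [RHS]curvatureE //; exact: (flow r Jr).1.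
pose da t k := \sum_m angle_mx (edge_lengths (x s) t) k m * K 0 (lab t (eset m)).
have df : is_derive s 1 f (0 - \sum_t \sum_k (lab t (eset k) == i)%:R * da t k).
  apply: (is_derive_addf (is_derive_constf (2 * pi) s)); apply: is_derive_oppf.
  apply: is_derive_sumr => t; apply: is_derive_sumr => k.
  have [l0 _ D0] := cone_metric_tet t hx.
  have dl m : is_derive s 1 (fun r => edge_lengths (x r) t m) (K 0 (lab t (eset m))).
    by rewrite mxE; exact: dx.
  apply: (is_derive_eq (is_derive_mulf (is_derive_constf (lab t (eset k) == i)%:R s)
    (is_derive_fcos dl (fun m => l0 (eset m)) D0 k))).
  by rewrite mul0r add0r.
apply: (is_derive_eq df); rewrite sub0r.
have -> : \sum_j curv_mx (x s) i j * curvature lab (x s) j = (curv_mx (x s) *m K^T) i 0.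
  by rewrite mxE; apply: eq_bigr => j _; rewrite !mxE.
rewrite /curv_mx mulNmx mxE mulmx_suml summxE; congr (- _); apply: eq_bigr => t _.
rewrite -!mulmxA mxE; apply: eq_bigr => k _; rewrite [_^T _ _]mxE [incidence t _ _]mxE.
congr (_ * _); rewrite mxE; apply: eq_bigr => m _; congr (_ * _).
have -> : incidence t *m K^T = (K *m (incidence t)^T)^T by rewrite trmx_mul trmxK.
by rewrite [RHS]mxE row_incidence.
Qed.

Lemma cvg_curv_mx (x : R -> 'rV[R]_n) (s : R) : cone_metric lab (x s) ->
  (forall i, x r 0 i @[r --> s] --> x s 0 i) ->
  forall i j, curv_mx (x r) i j @[r --> s] --> curv_mx (x s) i j.
Proof.
move=> hx cx i j.
have E y : curv_mx y i j = - \sum_t \sum_m \sum_k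
    (incidence t)^T i k * angle_mx (edge_lengths y t) k m * incidence t m j.
  rewrite mxE summxE; congr (- _); apply: eq_bigr => t _.
  by rewrite mxE; apply: eq_bigr => m _; rewrite mxE mulr_suml.
have H t m k : (incidence t)^T i k * angle_mx (edge_lengths (x r) t) k m
      * incidence t m j @[r --> s] -->
    (incidence t)^T i k * angle_mx (edge_lengths (x s) t) k m * incidence t m j.
  apply: cvgM; last exact: cvg_cst.
  apply: cvgM; first exact: cvg_cst.
  have [l0 _ D0] := cone_metric_tet t hx.
  apply: (cvg_angle_mx (l := fun r => edge_lengths (x r) t)) => // k'; first exact: cx.
  exact: l0.
rewrite E; under eq_fun do rewrite E.
apply: cvgN; do 3![apply: cvg_big => [|? _]; first exact: add_continuous].
exact: H.
Qed.

(** * Decrease of the total curvature *)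

Section AlongFlow.
Variables (J : set R) (x : R -> 'rV[R]_n).
Hypothesis lab_surj : forall i, exists t (e : {set 'I_4}), #|e| = 2%N /\ lab t e = i.
Hypothesis oJ : open J.
Hypothesis iJ : is_interval J.
Hypothesis flow : curvature_flow lab J x.

Let K r : 'rV[R]_n := \row_i curvature lab (x r) i.
Let S r := total_curvature lab (x r).
Let q r := (K r *m curv_mx (x r) *m (K r)^T) 0 0.

Let dS s : J s -> is_derive s 1 S (2 * q s).
Proof.
move=> Js; have dK := is_derive_curvature oJ flow Js.
apply: (is_derive_eq (is_derive_sumr (fun i => is_derive_sqrf (dK i)))).
rewrite /q quadE exchange_big mulr_sumr /=; apply: eq_bigr => i _.
rewrite !mulr_sumr; apply: eq_bigr => j _; rewrite !mxE; ring.
Qed.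

Let SE s : S s = \sum_i K s 0 i ^+ 2.
Proof. by apply: eq_bigr => i _; rewrite mxE. Qed.

Let S_ge0 s : 0 <= S s.
Proof. by rewrite SE sumr_ge0 // => i _; exact: sqr_ge0. Qed.

Let S_eq0 s : S s = 0 -> K s = 0.
Proof.
rewrite SE => /eqP; rewrite psumr_eq0 => [/allP h|i _]; last exact: sqr_ge0.
apply/rowP => i; rewrite [RHS]mxE; apply/eqP.
by rewrite -sqrf_eq0; exact: (h i (mem_index_enum i)).
Qed.

Let q_lt0 s : J s -> K s != 0 -> q s < 0.
Proof. by move=> Js; apply: curv_mx_negdef => //; case: (flow Js). Qed.

Let q_le0 s : J s -> q s <= 0.
Proof.
move=> Js; have [K0|/(q_lt0 Js)/ltW//] := eqVneq (K s) 0.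
by rewrite /q K0 !mul0mx mxE.
Qed.

Let sub_interval a b c : J a -> J b -> a <= c <= b -> J c.
Proof. by move=> Ja Jb; apply: iJ. Qed.

Let mvt (f df : R -> R) a b : a < b -> J a -> J b ->
  (forall c, J c -> is_derive c 1 f (df c)) ->
  exists2 c, a < c < b & f b - f a = df c * (b - a).
Proof.
move=> ab Ja Jb dfc.
have Jc c : a <= c <= b -> J c by exact: sub_interval.
have [||c] := @MVT _ f df a b ab.
- by move=> c; rewrite in_itv /= => /andP[ac cb]; apply/dfc/Jc; rewrite !ltW.
- apply: derivable_within_continuous => c; rewrite in_itv /= => acb.
  by have [] := dfc c (Jc c acb).
by rewrite in_itv /=; exists c.
Qed.

Let S_decr s t : J s -> J t -> s <= t -> S t <= S s.
Proof.
rewrite le_eqVlt => Js Jt /orP[/eqP -> //|st].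
have [c /andP[sc ct] E] := mvt st Js Jt dS.
have Jc : J c by apply: (sub_interval Js Jt); rewrite !ltW.
rewrite -subr_le0 E pmulr_lle0 ?subr_gt0 // pmulr_rle0 //.
exact: q_le0.
Qed.

(** Each product of two curvatures is at most half the sum of their squares, hence at most [S s]. *)
Let bound s : `|q s| <= (\sum_j \sum_i `|curv_mx (x s) i j|) * S s.
Proof.
rewrite /q quadE mulr_suml (le_trans (ler_norm_sum _ _ _)) //.
apply: ler_sum => j _; rewrite mulr_suml (le_trans (ler_norm_sum _ _ _)) //.
apply: ler_sum => i _; rewrite mulrAC normrM mulrC ler_wpM2l //.
have sq k : K s 0 k ^+ 2 <= S s.
  by rewrite SE (bigD1 k) //= lerDl sumr_ge0 // => m _; exact: sqr_ge0.
have := sq i; have := sq j; have := sqr_ge0 (`|K s 0 i| - `|K s 0 j|).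
rewrite normrM sqrrB !real_normK ?num_real //.
by move: (`|_|) (`|_|) => a b; lra.
Qed.

(* Gronwall: [exp (C r) * S r] is nondecreasing on a segment where the
   coefficients of the heat equation are bounded by [C / 2]. *)
Let curv_neq0 s t : J s -> J t -> K s != 0 -> K t != 0.
Proof.
move=> Js Jt; apply: contra_neq => Kt.
have St : S t = 0 by rewrite SE Kt big1 // => i _; rewrite mxE expr0n.
apply: S_eq0; apply/eqP; rewrite eq_le S_ge0 andbT.
(* Zero curvature persists forward by monotonicity; only the backward direction needs Gronwall's
   inequality. *)
have [ts|st] := leP t s; first by rewrite -St S_decr.
have Jc c : s <= c <= t -> J c by exact: sub_interval.
pose B r := \sum_j \sum_i `|curv_mx (x r) i j|.
have cB : {within `[s, t], continuous B}.
  apply: continuous_in_subspaceT => r; rewrite inE /= in_itv /= => rst.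
  have [hx dx] := flow (Jc r rst).
  do 2![apply: cvg_big => [|? _]; first exact: add_continuous].
  apply: cvg_norm; apply: cvg_curv_mx => // i.
  have [h _] := dx i.
  by apply/differentiable_continuous/derivable1_diffP.
have [c _ Bmax] := EVT_max (ltW st) cB.
pose C := 2 * B c.
pose E r := expR (C * r) * S r.
have dE r : J r -> is_derive r 1 E (expR (C * r) * (C * S r + 2 * q r)).
  move=> Jr.
  have de : is_derive r 1 (fun y => expR (C * y)) (expR (C * r) * C).
    have dl : is_derive r 1 (fun y => C * y) C.
      apply: (is_derive_eq (is_derive_mulf (is_derive_constf C r) (is_derive_id r 1))).
      by rewrite mul0r add0r mulr1.
    exact: (is_derive1_comp (g := fun y => C * y) (is_derive_expR (C * r)) dl).
  by apply: (is_derive_eq (is_derive_mulf de (dS Jr))); ring.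
have [r /andP[sr rt] Er] := mvt st Js Jt dE.
have : 0 <= E t - E s.
  rewrite Er mulr_ge0 ?subr_ge0 ?(ltW st) // mulr_ge0 ?expR_ge0 //.
  have Br : B r <= B c by apply: Bmax; rewrite in_itv /= !ltW.
  have := le_trans (bound r) (ler_wpM2r (S_ge0 r) Br).
  by rewrite ler_norml => /andP[h _]; rewrite /C; lra.
rewrite /E St mulr0 sub0r oppr_ge0 pmulr_rle0 ?expR_gt0 //.
Qed.

(** By [curv_neq0] the curvature is nonzero also at the intermediate time of the mean value theorem,
    so the derivative there is strictly negative. *)
Lemma total_curvature_decr r i s t : J r -> curvature lab (x r) i != 0 ->
  J s -> J t -> s < t -> total_curvature lab (x t) < total_curvature lab (x s).
Proof.
move=> Jr Ki Js Jt st.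
have Kr : K r != 0 by apply/rV0Pn; exists i; rewrite mxE.
have [c /andP[sc ct] E] := mvt st Js Jt dS.
have Jc : J c by apply: (sub_interval Js Jt); rewrite !ltW.
rewrite -/(S t) -/(S s) -subr_lt0 E pmulr_llt0 ?subr_gt0 // pmulr_rlt0 //.
exact: q_lt0 (curv_neq0 Jr Jc Kr).
Qed.

End AlongFlow.

End CurvatureFlow.

Theorem theorem2 (R : realType) (M : topologicalType) (T : finType)
    (G : face_pairing T) (n : nat) (lab : T -> {set 'I_4} -> 'I_n)
    (hM : ideal_triangulation R M G) (hlab : edge_labelling G lab) :
  exists A : 'rV[R]_n -> 'M[R]_n,
    (forall x, cone_metric lab x ->
       (A x)^T = A x /\ negative_definite (A x)) /\
    (forall (J : set R) (x : R -> 'rV[R]_n),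
       open J -> is_interval J -> curvature_flow lab J x ->
       (forall t, J t -> forall i : 'I_n,
          is_derive t (1 : R) (fun s => curvature lab (x s) i)
            (\sum_(j < n) A (x t) i j * curvature lab (x t) j)) /\
       ((exists2 t, J t & exists i, curvature lab (x t) i != 0) ->
        forall s t, J s -> J t -> s < t ->
          total_curvature lab (x t) < total_curvature lab (x s))).
Proof.
exists (curv_mx lab); split=> [x hx|J x oJ iJ flow].
  by split; [exact: tr_curv_mx | exact: curv_mx_negdef hlab.2 hx].
split=> [t Jt i|[r Jr [i Ki]] s t]; first exact: (is_derive_curvature oJ flow Jt).
exact: (total_curvature_decr hlab.2 oJ iJ flow Jr Ki).
Qed.
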